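(* Let $G = KL$ be a finite solvable Frobenius group which is a $\mathbf{GC}^*$-group, with Frobenius kernel $K = G_\infty$ and complement $L$. Then either $K$ is an elementary abelian $q$-group for some prime $q$, or $K$ is a Suzuki $2$-group with $|K| = |K'|^2$, $L$ is cyclic and $|L| = |K'|-1$.
   Context: $G_\infty$ denotes the nilpotent residual of $G$, i.e. the last term of the lower central series of $G$. A non-abelian $2$-group $K$ is a Suzuki $2$-group if $K$ has more than one involution and there exists a solvable group of automorphisms of $K$ acting transitively on the set of involutions of $K$. Galois automorphisms act on characters by $\chi^\alpha(g)=\chi(g)^\alpha$; two irreducible characters of $G$ are Galois conjugate if one is the image of the other under some element of $\mathrm{Gal}(\mathbb{Q}_n|\mathbb{Q})$ with $|G|$ dividing $n$. A finite group is a $\mathbf{GC}^*$-group if any two of its non-linear irreducible characters of the same degree are Galois conjugate. *)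

(* Defs.v *)
From mathcomp Require Import all_boot all_order all_algebra all_fingroup all_solvable abelian all_field all_character frobenius.
Set Implicit Arguments. Unset Strict Implicit. Unset Printing Implicit Defensive.
Import GRing.Theory Num.Theory.
Local Open Scope group_scope.

(* G_oo : the last term of the lower central series of G.  The series
   'L_1(G) >= 'L_2(G) >= ... stabilises after at most #|G| steps. *)
Definition nil_residual (gT : finGroupType) (G : {set gT}) : {set gT} :=
  'L_#|G|.+1(G).

Definition involutions (gT : finGroupType) (K : {set gT}) : {set gT} :=
  [set x in K | #[x] == 2%N].

Definition Suzuki_2group (gT : finGroupType) (K : {group gT}) : Prop :=
  [/\ 2.-group K, ~~ abelian K, (1 < #|involutions K|)%N &
      exists A : {group {perm gT}},
        [/\ A \subset Aut K, solvable A & [transitive A, on involutions K | 'P]]].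

Local Open Scope ring_scope.

(* Galois conjugacy of characters: phi = psi^alpha for some field
   automorphism alpha (of algC, equivalently of Q_n with |G| dividing n). *)
Definition Galois_conjugate (gT : finGroupType) (G : {group gT})
  (phi psi : 'CF(G)) : Prop :=
  exists u : {rmorphism algC -> algC}, psi = cfAut u phi.

Definition GCstar (gT : finGroupType) (G : {group gT}) : Prop :=
  forall i j : Iirr G,
    'chi_i 1%g != 1 -> 'chi_j 1%g != 1 -> 'chi_i 1%g = 'chi_j 1%g ->
    Galois_conjugate 'chi_i 'chi_j.

(* Main.v *)
Require Import Defs.
From mathcomp Require Import all_boot all_order all_algebra all_fingroup all_solvable abelian all_field all_character frobenius.
From mathcomp Require Import zify.
Set Implicit Arguments. Unset Strict Implicit. Unset Printing Implicit Defensive.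
Import Order.TTheory GroupScope GRing.Theory Num.Theory.
Local Open Scope ring_scope.

(** Characters of [G] induced from [K] turn GC* into a statement on [K]: two
    nontrivial irreducible characters of [K] of the same degree are conjugate under
    [L] and the Galois group.  For linear characters this makes [K / K'] elementary
    abelian of order [q ^ n], and the [(q ^ n - 1) / (q - 1)] hyperplanes of [K / K']
    form one [L]-orbit.  Suppose [K' != 1].  An involution in [L] would invert [K],
    so [L] has odd order; counting the degrees of the characters over a central
    subgroup shows that the first two factors of the lower central series of [K]
    below [K'] have order [q ^ n] as well.

    If [q] is odd and [K] has class 2, then [n] is odd, and the characters over a
    given [lam] in [Irr K'], which all have the same degree, form one Galois orbit.
    This forces the radical of the form [lam [x, y]] on [K / K'] to be a line
    spanned by an [x] with [lam (x ^ q) != 1].  Identifying [K / K'] with [K'] by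
    [x -> x ^ q], every [y -> [x, y]] with [x != 1] becomes an endomorphism with
    a one-dimensional kernel not contained in its image, so that the linear
    coefficient of its characteristic polynomial is nonzero.  This coefficient is
    a form of degree [n - 1] in [n] variables, and Chevalley-Warning gives a
    nontrivial zero, a contradiction.

    If [q = 2], then [L] is regular on the nontrivial elements of [K / K'].  In
    class 2 all involutions lie in [K'], whence the Suzuki case.  In class 3 the
    same Chevalley-Warning argument applies to [z -> [x, z]] from [K' / M] to
    [M = [K', K]], identified by [z -> z ^ 2], with [x ^ 2] as kernel vector. *)

(** * Frobenius groups *)

(* The sums of [rG] over [G], over [K] and over the conjugates of [H] are
   linked by the Frobenius partition; all but the one over [K] vanish. *)
Lemma Frobenius_rfix_compl_rker (gT : finGroupType) (G K H : {group gT})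
    (F : fieldType) n (rG : mx_representation F G n) :
  [Frobenius G = K ><| H] -> rfix_mx rG H = 0 -> #|K|%:R != 0 :> F ->
  K \subset rker rG.
Proof.
move=> frobG fixH nzK.
have [defG _ ntH _ _] := Frobenius_context frobG.
have [_ /mulG_sub[sKG sHG] _ _] := sdprodP defG.
pose S (A : {set gT}) := \sum_(g in A) rG g.
have S_fix (A : {group gT}) a : A \subset G -> a \in A -> S A *m rG a = S A.
  move=> sAG Aa; rewrite /S mulmx_suml [RHS](reindex_inj (mulIg a)) /=.
  apply: eq_big => g; first by rewrite groupMr.
  by move=> Ag; rewrite repr_mxM ?(subsetP sAG).
have S0 (A : {group gT}) : A \subset G -> rfix_mx rG A = 0 -> S A = 0.
  move=> sAG fixA; apply/eqP; rewrite -submx0 -fixA; apply/rfix_mxP=> a Aa.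
  exact: S_fix.
have SG : S G = 0.
  apply: S0 => //; apply/eqP; rewrite -submx0 -fixH.
  by apply/rfix_mxP=> a Ha; rewrite rfix_mx_id // (subsetP sHG).
have SHx x : x \in K -> S (H^# :^ x) = - 1%:M.
  move=> Kx; have Gx := subsetP sKG x Kx.
  have: S (H :^ x)%G = 0.
    apply: S0; first by rewrite -(conjGid Gx) conjSg.
    by apply/eqP; rewrite -submx0 rfix_mx_conjsg // fixH mul0mx.
  rewrite /S (bigD1 (1%g : gT)) ?group1 //= repr_mx1 => /eqP.
  rewrite addrC addr_eq0 => /eqP <-; apply: eq_bigl => g.
  by rewrite conjD1g !inE andbC.
have := SG; rewrite /S.
have /and3P[/eqP covG tiG _] := Frobenius_partition frobG.
rewrite -{1}covG (big_trivIset _ tiG) /= big_setU1 /=; last first.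
  apply/imsetP=> -[x _ E]; have := group1 K.
  by rewrite E conjD1g !inE eqxx.
rewrite [X in _ + X](eq_bigr (fun _ => - 1%:M)) => [|_ /imsetP[x Kx ->]]; last exact: SHx.
rewrite sumr_const; set c := #|_|.
have -> : c = #|K|.
  rewrite /c card_conjugates -divgI -[RHS]divn1; congr (_ %/ _)%N.
  have [/eqP _ _ /normedTI_memJ_P[_ _ tiHG]] := and3P frobG.
  apply/eqP; rewrite -trivg_card1 -subG1; apply/subsetP=> y /setIP[Ky /setIP[_ nHy]].
  have [_ _ _ tiKH] := sdprodP defG; rewrite -tiKH inE Ky /=.
  have [h Hh nth] := trivgPn _ ntH.
  have H1h: h \in H^# by rewrite !inE nth.
  by rewrite -(tiHG h) ?memJ_norm ?(subsetP sKG).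
move/eqP; rewrite mulNrn subr_eq0 => /eqP SK.
apply/subsetP=> a Ka; apply/rkerP; split; first exact: (subsetP sKG).
have := S_fix K a sKG Ka; rewrite /S SK -scaler_nat -scalemxAl mul1mx.
move=> E; have := congr1 (fun M => #|K|%:R^-1 *: M) E.
by rewrite !scalerA mulVf // !scale1r.
Qed.

Lemma Frobenius_quotient_ker (gT : finGroupType) (G K H N : {group gT}) :
    [Frobenius G = K ><| H] -> N <| G -> N \proper K ->
  [Frobenius G / N = (K / N) ><| (H / N)].
Proof.
move=> frobG nsNG ltNK; have [defG _ ntH _ _] := Frobenius_context frobG.
apply: Frobenius_coprime_quotient => //.
  by split=> //; apply: Frobenius_coprime frobG.
by split=> // x Hx; rewrite (Frobenius_reg_ker frobG) ?sub1G.
Qed.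

(** Induction on [#|K|]: modulo a minimal normal [r]-subgroup [R] of [G] the kernel is a [q]-group.
    If [r != q], an [H]-invariant Sylow [q]-subgroup [Q] gives a Frobenius group [Q <*> H] acting on
    [R] without nontrivial [H]-fixed points, so [Q] centralizes [R]. Then
    [K^](1)[lies in]Q[, and]#|R| = #|K : Q|[divides]#|K : K^[(1)|]. *)
Lemma Frobenius_ker_pgroup (gT : finGroupType) (G K H : {group gT}) q :
    [Frobenius G = K ><| H] -> solvable G -> prime q ->
  q.-nat #|K : K^`(1)| -> q.-group K.
Proof.
have [m] := ubnP #|K|; elim: m => // m IHm in gT G K H *.
rewrite ltnS => leKm frobG solG pr_q qK.
have [defG ntK ntH _ _] := Frobenius_context frobG.
have [nsKG sHG _ nKH _] := sdprod_context defG.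
have [sKG nKG] := andP nsKG.
have solK := solvableS sKG solG; have solH := solvableS sHG solG.
have [R minR sRK] := minnormal_exists ntK nKG.
have [nRG ntR /is_abelemP[r pr_r abelR]] := minnormal_solvable minR sRK solK.
have [rR cRR _] := and3P abelR.
have nsRG : R <| G by rewrite /normal (subset_trans sRK).
have nRK : K \subset 'N(R) := subset_trans sKG nRG.
have [eRK | neRK] := eqVneq (R : {set gT}) K.
  move: qK; rewrite (eqP (_ : K^`(1)%g == 1%g)) ?indexg1 //.
  by rewrite -eRK; apply/eqP/derG1P.
have ltRK : R \proper K by rewrite properEneq neRK.
have qKR : q.-group (K / R).
  have frobGR := Frobenius_quotient_ker frobG nsRG ltRK.
  apply: IHm frobGR _ _ _ => //; first exact: leq_trans (ltn_quotient ntR sRK) _.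
    exact: quotient_sol.
  rewrite -quotient_der //; apply: pnat_dvd qK; apply: index_morphim.
  by rewrite subIset ?nRK.
have [erq | neqrq] := eqVneq r q.
  by rewrite -(pquotient_pgroup _ nRK) // -erq.
have coKH := Frobenius_coprime frobG.
have [Q sylQ nQH] := sol_coprime_Sylow_exists q solH nKH coKH.
have [sQK qQ _] := and3P sylQ.
have q'R : q^'.-group R by apply: sub_in_pnat rR => p _ /eqnP ->; rewrite !inE.
have coRQ : coprime #|R| #|Q| by rewrite coprime_sym (pnat_coprime qQ).
have defK : (R * Q = K)%g.
  apply/eqP; rewrite eqEcard mul_subG //= coprime_cardMg //.
  rewrite -(Lagrange sRK) leq_mul2l -card_quotient //; apply/orP; right.
  have [_ _ qQK] := and3P sylQ.
  rewrite (card_Hall sylQ) dvdn_leq ?part_gt0 //.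
  rewrite -(part_pnat_id qKR) partn_dvd ?cardG_gt0 //; exact: dvdn_quotient.
have ntQ : Q :!=: 1%g.
  by apply: contraNneq neRK => Q1; rewrite -defK Q1 mulg1.
have frobQ := Frobenius_subl ntQ sQK nQH frobG.
have nRQH : Q <*> H \subset 'N(R).
  by rewrite (subset_trans _ nRG) // join_subG sHG (subset_trans sQK).
have cRQ : Q \subset 'C(R).
  have := Frobenius_rfix_compl_rker (rG := abelem_repr abelR ntR nRQH) frobQ.
  rewrite rker_abelem => cRQ; apply: subset_trans (cRQ _ _) (subsetIr _ _).
    apply/eqP; rewrite -submx0 rfix_abelem ?joing_subr //.
    have -> : 'C_R(H) = 1%g.
      by apply/trivgP; rewrite -(Frobenius_trivg_cent frobG); apply: setSI.
    by rewrite morphim1 rowg_mx1.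
  rewrite -(dvdn_pcharf (pchar_Fp pr_r)) -prime_coprime //.
  apply: coprime_dvdl coRQ.
  have [k oR] := p_natP rR; rewrite oR; have := ntR; rewrite -cardG_gt1 oR.
  by case: k {oR} => // k _; rewrite expnS dvdn_mulr.
have nsQK : Q <| K.
  rewrite /normal sQK -defK mul_subG ?normG //.
  by rewrite cents_norm // centsC.
have sK'Q : K^`(1)%g \subset Q.
  by rewrite der1_min ?normal_norm // -defK quotientMidr quotient_abelian.
have qR : q.-nat #|R|.
  have := pnat_dvd (indexgS K sK'Q) qK.
  by rewrite -divgS // -{1}defK coprime_cardMg // mulnK ?cardG_gt0.
case/eqP: ntR; apply/card1_trivg; exact: pnat_1 qR q'R.
Qed.

(* An involution of [H] inverts [K], since every element of [K] has the form
   [x^-1 * x ^ t]. *)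
Lemma semiregular_nonabelian_odd (gT : finGroupType) (K H : {group gT}) :
  H \subset 'N(K) -> semiregular K H -> ~~ abelian K -> odd #|H|.
Proof.
move=> nKH regH; apply: contraR; rewrite -dvdn2 => even_H.
have [t Ht ot] := Cauchy (isT : prime 2) even_H.
have nt_t: t \in H^# by rewrite !inE Ht -order_gt1 ot.
have nKt := subsetP nKH t Ht.
have t2: (t * t = 1)%g by rewrite -expg2 -ot expg_order.
pose f x := (x^-1 * x ^ t)%g.
have f_inj: {in K &, injective f}.
  move=> x y Kx Ky /= fxy; apply/eqP; rewrite eq_mulgV1.
  have: (x * y^-1)%g \in 'C_K[t].
    rewrite inE groupM ?groupV //=; apply/cent1P/commgP/conjg_fixP.
    rewrite conjMg conjVg; apply: (mulgI x^-1%g); rewrite mulgA -/(f x) fxy.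
    by rewrite /f mulgK mulKg.
  by rewrite (regH t) // => /set1P->.
have fK: f @: K = K.
  apply/eqP; rewrite eqEcard card_in_imset // leqnn andbT.
  by apply/subsetP=> _ /imsetP[x Kx ->]; rewrite groupM ?groupV ?memJ_norm.
have invK x : x \in K -> (x ^ t = x^-1)%g.
  rewrite -{1}fK => /imsetP[y Ky ->].
  by rewrite /f conjMg conjVg -conjgM t2 conjg1 [RHS]invMg invgK.
rewrite /abelian; apply/centsP=> x Kx y Ky; apply/eqP.
rewrite -(inj_eq invg_inj) -(invK (x * y)%g) ?groupM //.
by rewrite conjMg !invK // invMg.
Qed.

(** An elementary abelian subgroup [E] of maximal rank acts faithfully and irreducibly on a minimal
    [E]-invariant subgroup of [K], hence is cyclic; an odd [p]-group of rank at most one is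
    cyclic. *)
Lemma semiregular_odd_pgroup_cyclic (gT : finGroupType) (K P : {group gT})
    (p : nat) :
    solvable K -> K :!=: 1%g -> P \subset 'N(K) -> semiregular K P ->
  p.-group P -> odd #|P| -> cyclic P.
Proof.
move=> solK ntK nKP regP pP oddP; rewrite (odd_pgroup_rank1_cyclic pP oddP).
have [E Er] := p_rank_witness p P; have [sEP abelE dimE] := pnElemP Er.
rewrite -dimE -(p_rank_abelem abelE).
have [_ cEE _] := and3P abelE.
have nKE := subset_trans sEP nKP.
have [R minR sRK] := minnormal_exists ntK nKE.
have [nRE ntR /is_abelemP[r pr_r abelR]] := minnormal_solvable minR sRK solK.
suffices: cyclic E.
  by rewrite (odd_pgroup_rank1_cyclic (pgroupS sEP pP)) // (oddSg sEP).
have faithE : mx_faithful (abelem_repr abelR ntR nRE).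
  apply: abelem_mx_faithful; apply/trivgP/subsetP=> x /setIP[Ex cRx].
  apply: contraR ntR; rewrite inE => ntx.
  rewrite -subG1 -(regP x) ?inE ?ntx ?(subsetP sEP) // subsetI sRK /=.
  by rewrite -cent_set1 centsC sub1set.
by apply: mx_faithful_irr_abelian_cyclic faithE _ cEE; apply/abelem_mx_irrP.
Qed.

Lemma Frobenius_compl_odd_nil_cyclic (gT : finGroupType) (G K H : {group gT}) :
  [Frobenius G = K ><| H] -> solvable K -> odd #|H| -> nilpotent H -> cyclic H.
Proof.
move=> frobG solK oddH nilH; have [defG ntK _ _ _] := Frobenius_context frobG.
have [_ _ nKH _] := sdprodP defG.
apply: nil_Zgroup_cyclic nilH; apply/forall_inP=> P /SylowP[p pr_p sylP].
have [sPH pP _] := and3P sylP.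
apply: semiregular_odd_pgroup_cyclic (subset_trans sPH nKH) _ pP _ => //.
  exact: semiregularS (Frobenius_reg_ker frobG).
exact: oddSg oddH.
Qed.

(** * A Chevalley-Warning argument *)

(** For [a > 0] some unit [y] has [y ^+ a != 1], because ['X^a - 1] has at most [a] roots;
    substituting [y * x] for [x] multiplies the sum by [y ^+ a]. For [a = 0] all [#|F|] terms are 1,
    [0 ^+ 0] included. *)
Lemma sum_expr_finField (F : finFieldType) a :
  (a < #|F|.-1)%N -> \sum_(x : F) x ^+ a = 0.
Proof.
move=> lt_a; case: (posnP a) => [-> | a_gt0].
  rewrite (eq_bigr (fun _ => 1)) => [|x _]; last by rewrite expr0.
  have := expg_cardG (in_setT (1 : F)); rewrite FinRing.zmodXgE cardsT => /eqP F0.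
  by rewrite sumr_const; apply/eqP.
have [y /andP[nz_y ya] | all1] := pickP [pred y : F | (y != 0) && (y ^+ a != 1)];
  last first.
  suffices: (#|F|.-1 <= a)%N by rewrite leqNgt lt_a.
  rewrite -(cardC1 (0 : F)) cardE max_unity_roots ?enum_uniq //.
  apply/allP=> y; rewrite mem_enum inE => nz_y; rewrite unity_rootE.
  by have := all1 y; rewrite /= nz_y => /negbFE.
have /eqP : (y ^+ a - 1) * \sum_(x : F) x ^+ a = 0.
  rewrite mulrBl mul1r [X in _ - X](reindex_inj (mulfI nz_y)) /=.
  by rewrite mulr_sumr -sumrB big1 // => x _; rewrite exprMn subrr.
by rewrite mulf_eq0 subr_eq0 (negPf ya) => /eqP.
Qed.

(** Functions given by a polynomial of total degree at most [d], as sums of monomials. Only values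
    matter, so pointwise equations replace equality of functions. *)
Inductive polyfun (F : finFieldType) n (d : nat) : ('rV[F]_n -> F) -> Prop :=
| PolyMono c (a : 'I_n -> nat) (f : 'rV[F]_n -> F) of (\sum_i a i <= d)%N &
    (forall v, f v = c * \prod_i v 0 i ^+ a i) : polyfun d f
| PolyAdd (f g h : 'rV[F]_n -> F) of polyfun d f & polyfun d g &
    (forall v, h v = f v + g v) : polyfun d h.

Section PolyFun.

Variables (F : finFieldType) (n : nat).
Implicit Types f g : 'rV[F]_n -> F.

Lemma polyfun_ext d f g : f =1 g -> polyfun d f -> polyfun d g.
Proof.
move=> eq_fg Pf; case: Pf eq_fg => [c a f' le_ad def_f | f1 f2 f' P1 P2 def_f] eq_fg.
  by apply: (@PolyMono _ _ _ c a g) => // v; rewrite -eq_fg.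
by apply: (PolyAdd P1 P2) => v; rewrite -eq_fg.
Qed.

Lemma polyfun_const d c : polyfun d (fun _ : 'rV[F]_n => c).
Proof.
apply: (@PolyMono _ _ _ c (fun=> 0%N)); first by rewrite big1.
by move=> v; rewrite big1 ?mulr1 // => i _; rewrite expr0.
Qed.

Lemma polyfunD d f g :
  polyfun d f -> polyfun d g -> polyfun d (fun v => f v + g v).
Proof. by move=> Pf Pg; apply: (PolyAdd Pf Pg). Qed.

Lemma polyfun_coord c i : polyfun 1 (fun v : 'rV[F]_n => v 0 i * c).
Proof.
apply: (@PolyMono _ _ _ c (fun j => (j == i) : nat)).
  by rewrite (bigD1 i) //= eqxx big1 => // j /negPf ->.
move=> v; rewrite (bigD1 i) //= eqxx expr1 big1 => [|j /negPf ->].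
  by rewrite mulr1 mulrC.
by rewrite expr0.
Qed.

Lemma polyfun_sum d (I : Type) (r : seq I) (P : pred I) (f : I -> 'rV[F]_n -> F) :
  (forall i, P i -> polyfun d (f i)) ->
  polyfun d (fun v => \sum_(i <- r | P i) f i v).
Proof.
move=> Pf; elim: r => [|i r IHr].
  by apply: polyfun_ext (polyfun_const d 0) => v; rewrite big_nil.
have [Pi | Pi'] := boolP (P i).
  by apply: polyfun_ext (polyfunD (Pf i Pi) IHr) => v; rewrite big_cons Pi.
by apply: polyfun_ext IHr => v; rewrite big_cons (negPf Pi').
Qed.

Lemma polyfunM d1 d2 f g :
  polyfun d1 f -> polyfun d2 g -> polyfun (d1 + d2) (fun v => f v * g v).
Proof.
move=> Pf Pg; elim: Pf => {f} [c a f le_a def_f | f1 f2 f _ P1 _ P2 def_f].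
  elim: Pg => {g} [c' b g le_b def_g | g1 g2 g _ P1 _ P2 def_g].
    apply: (@PolyMono _ _ _ (c * c') (fun i => a i + b i)%N).
      by rewrite big_split leq_add.
    move=> v; rewrite def_f def_g mulrACA -big_split; congr (_ * _).
    by apply: eq_bigr => i _; rewrite exprD.
  by apply: polyfun_ext (polyfunD P1 P2) => v; rewrite def_g mulrDr.
by apply: polyfun_ext (polyfunD P1 P2) => v; rewrite def_f mulrDl.
Qed.

Lemma polyfunX d f k : polyfun d f -> polyfun (d * k) (fun v => f v ^+ k).
Proof.
move=> Pf; elim: k => [|k IHk].
  by apply: polyfun_ext (polyfun_const _ 1) => v; rewrite expr0.
by rewrite mulnS; apply: polyfun_ext (polyfunM Pf IHk) => v; rewrite exprS.
Qed.

(** The core of Chevalley-Warning: the sum of a monomial factors over the coordinates, and by the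
    degree bound some exponent is below [#|F| - 1], so that its factor vanishes. *)
Lemma polyfun_sum_eq0 d f :
  polyfun d f -> (d < n * #|F|.-1)%N -> \sum_v f v = 0.
Proof.
move=> Pf lt_d; elim: Pf => {f} [c a f le_a def_f | f1 f2 f _ P1 _ P2 def_f].
  rewrite (eq_bigr _ (fun v _ => def_f v)) -mulr_sumr.
  have -> : \sum_(v : 'rV[F]_n) \prod_i v 0 i ^+ a i
          = \prod_(i < n) \sum_(x : F) x ^+ a i.
    rewrite bigA_distr_bigA /=.
    rewrite (reindex (fun v : {ffun 'I_n -> F} => \row_i v i)) /=.
      by apply: eq_bigr => v _; apply: eq_bigr => i _; rewrite mxE.
    exists (fun v : 'rV[F]_n => [ffun i => v 0 i]) => v _.
      by apply/ffunP=> i; rewrite ffunE mxE.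
    by apply/rowP=> i; rewrite mxE ffunE.
  have [i lt_i | ge_a] := pickP [pred i | (a i < #|F|.-1)%N].
    by rewrite (bigD1 i) //= sum_expr_finField // mul0r mulr0.
  have: (n * #|F|.-1 <= \sum_i a i)%N.
    rewrite -[X in (X * _)%N]card_ord -sum_nat_const leq_sum // => i _.
    by have:= ge_a i; rewrite /= ltnNge => /negbFE.
  by move/leq_trans/(_ le_a); rewrite leqNgt lt_d.
by rewrite (eq_bigr _ (fun v _ => def_f v)) big_split /= P1 P2 addr0.
Qed.

(* Polynomial-valued functions, graded so that ['X] counts as degree 1. *)
Definition graded_polyfun d (f : 'rV[F]_n -> {poly F}) :=
  forall k, if (k <= d)%N then polyfun (d - k) (fun v => (f v)`_k)
            else forall v, (f v)`_k = 0.

Lemma graded_polyfun_ext d (f g : 'rV[F]_n -> {poly F}) :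
  f =1 g -> graded_polyfun d f -> graded_polyfun d g.
Proof.
move=> eq_fg Gf k; have := Gf k; case: ifP => _ Gk; last by move=> v; rewrite -eq_fg.
by apply: polyfun_ext Gk => v; rewrite eq_fg.
Qed.

Lemma graded_polyfun1 : graded_polyfun 0 (fun _ => 1).
Proof.
move=> k; case: ifP => [_|]; first exact: polyfun_const.
by case: k => // k _ v; rewrite coef1.
Qed.

Lemma graded_polyfunM d1 d2 (f g : 'rV[F]_n -> {poly F}) :
  graded_polyfun d1 f -> graded_polyfun d2 g ->
  graded_polyfun (d1 + d2) (fun v => f v * g v).
Proof.
move=> Gf Gg k; case: ifP => [le_k | gt_k].
  apply: polyfun_ext (fun v => esym (coefM (f v) (g v) k)) _.
  apply: polyfun_sum => -[j /= lt_jk] _; rewrite ltnS in lt_jk.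
  have := Gf j; case: ifP => [le_j Pf | _ f0]; last first.
    by apply: polyfun_ext (polyfun_const _ 0) => v; rewrite f0 mul0r.
  have := Gg (k - j)%N; case: ifP => [le_kj Pg | _ g0]; last first.
    by apply: polyfun_ext (polyfun_const _ 0) => v; rewrite g0 mulr0.
  by have := polyfunM Pf Pg; congr (polyfun _ _); lia.
move=> v; rewrite coefM big1 // => -[j /= lt_jk] _.
have := Gf j; case: ifP => [le_j _ | _ -> //]; last by rewrite mul0r.
have := Gg (k - j)%N; case: ifP => [le_kj _ | _ -> //]; last by rewrite mulr0.
by exfalso; lia.
Qed.

Lemma graded_polyfun_sum d (I : Type) (r : seq I) (f : I -> 'rV[F]_n -> {poly F}) :
  (forall i, graded_polyfun d (f i)) ->
  graded_polyfun d (fun v => \sum_(i <- r) f i v).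
Proof.
move=> Gf k; have Gk i := Gf i k; case: ifP Gk => _ Gk.
  apply: polyfun_ext (fun v => esym (coef_sum _ _ _ _)) _.
  by apply: polyfun_sum.
by move=> v; rewrite coef_sum big1.
Qed.

Lemma graded_polyfun_prod (I : Type) (r : seq I) (f : I -> 'rV[F]_n -> {poly F}) :
  (forall i, graded_polyfun 1 (f i)) ->
  graded_polyfun (size r) (fun v => \prod_(i <- r) f i v).
Proof.
move=> Gf; elim: r => [|i r IHr].
  by apply: graded_polyfun_ext graded_polyfun1 => v; rewrite big_nil.
by apply: graded_polyfun_ext (graded_polyfunM (Gf i) IHr) => v; rewrite big_cons.
Qed.

(** Each entry of ['X - D v] is graded of degree 1, so each term of the Leibniz expansion, having
    [n] factors, is graded of degree [n]. *)
Lemma graded_polyfun_char_poly (D : 'rV[F]_n -> 'M[F]_n) :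
  (forall i j, polyfun 1 (fun v => D v i j)) ->
  graded_polyfun n (fun v => char_poly (D v)).
Proof.
move=> PD; apply: graded_polyfun_sum => s.
have Gsign : graded_polyfun 0 (fun _ => (-1) ^+ s).
  move=> k; case: ifP => [_|]; first exact: polyfun_const.
  by case: k => // k _ v; rewrite -polyC1 -polyCN -polyC_exp coefC.
rewrite -[n in graded_polyfun n]add0n; apply: graded_polyfunM Gsign _.
have := @graded_polyfun_prod _ (index_enum 'I_n) (fun i v => char_poly_mx (D v) i (s i)).
have -> : size (index_enum 'I_n) = n.
  rewrite -[RHS]size_enum_ord; apply/perm_size/uniq_perm => [||i].
  - exact: index_enum_uniq.
  - exact: enum_uniq.
  by rewrite mem_index_enum mem_enum.
apply=> i k.
case: k => [|[|k]] /=.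
- rewrite subn0; apply: polyfun_ext (polyfunM (polyfun_const 0 (-1)) (PD i (s i))) => v.
  by rewrite !mxE coefB coefMn coefX mul0rn coefC sub0r mulN1r.
- apply: polyfun_ext (polyfun_const _ ((i == s i)%:R)) => v.
  by rewrite !mxE coefB coefMn coefX coefC subr0.
by move=> v; rewrite !mxE coefB coefMn coefX coefC mul0rn subr0.
Qed.

End PolyFun.

(** The same two block matrices multiplied in both orders have equal determinants; each product is
    block triangular. *)
Lemma det1D_rank1 (R : comUnitRingType) n (c : 'cV[R]_n) (r : 'rV[R]_n) :
  \det (1%:M + c *m r) = 1 + (r *m c) 0 0.
Proof.
have E1 : block_mx 1%:M r (- c) 1%:M *m block_mx 1%:M (- r) 0 1%:M =
          block_mx 1%:M 0 (- c) (1%:M + c *m r).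
  rewrite mulmx_block !mulmx1 !mul1mx !mulmx0 !addr0.
  by rewrite addNr mulNmx mulmxN opprK addrC.
have E2 : block_mx 1%:M (- r) 0 1%:M *m block_mx 1%:M r (- c) 1%:M =
          block_mx (1%:M + r *m c) 0 (- c) 1%:M.
  rewrite mulmx_block !mulmx1 !mul1mx !mul0mx !add0r.
  by rewrite mulNmx mulmxN opprK subrr.
have := congr1 determinant E1; have := congr1 determinant E2.
rewrite !det_mulmx !det_lblock !det1 mul1r mulr1 => E2' E1'.
rewrite -E1' mulrC E2' [1%:M + _]mx11_scalar det_scalar1.
by rewrite !mxE eqxx.
Qed.

(* The idempotent [E] splits off the kernel of [A], so that ['X] divides the
   characteristic polynomial exactly once. *)
Lemma char_poly_coef1_neq0 (F : fieldType) n (A : 'M[F]_n) (u : 'rV_n) (l : 'cV_n) :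
    u *m A = 0 -> A *m l = 0 -> (u *m l) 0 0 != 0 -> \rank A = n.-1 ->
  (char_poly A)`_1 != 0.
Proof.
move=> uA Al; set a := (u *m l) 0 0 => nz_a rkA.
pose E := a^-1 *: (l *m u).
have ul : u *m l = a%:M by rewrite [LHS]mx11_scalar.
have uE : u *m E = u.
  by rewrite /E -scalemxAr mulmxA ul mul_scalar_mx scalerA mulVf ?scale1r.
have EE : E *m E = E by rewrite {1}/E -scalemxAl -mulmxA uE.
have AE : A *m E = 0 by rewrite /E -scalemxAr mulmxA Al mul0mx scaler0.
(* A row [w] killed by [E - A] satisfies [w *m E = 0], hence [w *m A = 0]. By the rank hypothesis
   [w] is a multiple of [u], which [E] fixes, so [w = w *m E = 0]. *)
have unitEA : E - A \in unitmx.
  rewrite -row_free_unit; apply: inj_row_free => w.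
  rewrite mulmxBr => /eqP; rewrite subr_eq0 => /eqP wEA.
  have wE : w *m E = 0 by rewrite -EE mulmxA wEA -mulmxA AE mulmx0.
  have wA : (w <= kermx A)%MS by apply/sub_kermxP; rewrite -wEA.
  have nz_u : u != 0.
    by apply: contraNneq nz_a => u0; rewrite /a u0 mul0mx mxE.
  have n_gt0 : (0 < n)%N.
    by move: nz_u; rewrite -mxrank_eq0 -lt0n => /leq_trans; apply; apply: rank_leq_col.
  have keru : (u <= kermx A)%MS by apply/sub_kermxP.
  have eq_u : (u == kermx A)%MS.
    rewrite -(mxrank_leqif_eq keru) mxrank_ker rkA rank_rV nz_u.
    by case: (n) n_gt0 => // m _; rewrite subSnn.
  have /sub_rVP[c wc] : (w <= u)%MS by apply: submx_trans wA _; case/andP: eq_u.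
  by rewrite wc -uE scalemxAl -wc wE.
pose A' := map_mx polyC A; pose E' := map_mx polyC E.
pose u' := map_mx polyC u; pose l' := map_mx polyC l.
have EE' : E' *m E' = E' by rewrite /E' -map_mxM EE.
have AE' : A' *m E' = 0 by rewrite /E' /A' -map_mxM AE map_mx0.
(* Chosen so that ['X - A'] is [B] times a matrix of determinant ['X], while [B] specializes at 0 to
   the invertible [E - A]. *)
pose B := 'X *: (1%:M - E') - A' + E'.
have BE : B *m E' = E'.
  by rewrite /B mulmxDl mulmxBl -scalemxAl mulmxBl mul1mx EE' AE' subrr scaler0
             subrr add0r.
have defB : 'X%:M - A' = B *m (1%:M + ('X - 1) *: E').
  rewrite mulmxDr mulmx1 -scalemxAr BE /B scalerBl scale1r scalerBr scalemx1.
  by rewrite addrACA subrr addr0 addrAC subrK.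
have det2 : \det (1%:M + ('X - 1) *: E') = 'X.
  have -> : ('X - 1) *: E' = (('X - 1) * a^-1%:P) *: l' *m u'.
    by rewrite /E' /E map_mxZ map_mxM scalerA scalemxAl.
  rewrite det1D_rank1 -scalemxAr -map_mxM ul map_scalar_mx /= !mxE eqxx /=.
  by rewrite mulr1n -mulrA -polyCM mulVf // mulr1 addrC subrK.
rewrite /char_poly /char_poly_mx -/A' defB det_mulmx det2 coefMX /=.
rewrite -horner_coef0 -[_.[0]]/(horner_eval 0 _) -det_map_mx /=.
have -> : map_mx (horner_eval 0) B = E - A.
  apply/matrixP=> i j; rewrite !mxE /horner_eval.
  by rewrite !hornerE addrC.
by rewrite -unitfE.
Qed.

(* Chevalley-Warning for the linear coefficient of the characteristic
   polynomial of [D v], a form of degree [n - 1] in [n] variables. *)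
Lemma no_corank1_matrix_family (F : finFieldType) n (D : 'rV[F]_n -> 'M[F]_n)
    (S : 'M[F]_n) (u : 'rV[F]_n -> 'rV[F]_n) :
    (1 < n)%N -> S \in unitmx ->
    (forall i j, polyfun 1 (fun v => D v i j)) ->
    (forall v, v != 0 -> u v != 0) -> (forall v, u v *m D v = 0) ->
    (forall l : 'cV_n, l != 0 -> (#|[set v | D v *m l == 0%R]| <= #|F|)%N) ->
    (forall v (l : 'cV_n), v != 0 -> l != 0 -> D v *m l = 0 -> (u v *m S *m l) 0 0 != 0) ->
    D 0 = 0 ->
  False.
Proof.
move=> n_gt1 unitS PD nz_u uD card_l nz_ul D0.
pose R v := [set l : 'cV[F]_n | D v *m l == 0].
have F_gt1 := finNzRing_gt1 F; have n_gt0 := ltnW n_gt1.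
have cardR v : #|R v| = (#|F| ^ (n - \rank (D v)))%N.
  rewrite -mxrank_tr -mxrank_ker -card_rowg -(card_imset _ (@trmx_inj F n 1)).
  apply: eq_card => l; rewrite mem_rowg; apply/imsetP/sub_kermxP=> [[m] | lD].
    by rewrite inE => /eqP Dm ->; rewrite -trmx_mul Dm trmx0.
  exists l^T; last by rewrite trmxK.
  by rewrite inE -[D v]trmxK -trmx_mul lD trmx0.
have cardR_ge v : v != 0 -> (#|F| <= #|R v|)%N.
  move=> nz_v; rewrite cardR -{1}[#|F|]expn1 leq_exp2l // subn_gt0.
  rewrite ltn_neqAle rank_leq_row andbT; apply: contra (nz_u v nz_v) => rkDv.
  by rewrite -(mulmx_free_eq0 _ rkDv) uD.
(* Double count of the pairs of nonzero [v], [l] with [D v *m l = 0]: every [v] has at least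
   [#|F| - 1] partners, every [l] at most that many, and there are as many [v] as [l]. Hence
   equality holds for each [v]. *)
have rkD v : v != 0 -> \rank (D v) = n.-1.
  move=> nz_v; suffices: (#|R v| <= #|F|)%N.
    rewrite cardR -{2}[#|F|]expn1 leq_exp2l // => rk_ge.
    have := cardR_ge v nz_v; rewrite cardR -{1}[#|F|]expn1 leq_exp2l //.
    by have := rank_leq_row (D v); lia.
  pose c := (#|F| ^ n).-1.
  have card_v : #|[pred v : 'rV[F]_n | v != 0]| = c.
    by rewrite cardC1 card_mx mul1n.
  have card_l' : #|[pred l : 'cV[F]_n | l != 0]| = c.
    by rewrite cardC1 card_mx muln1.
  have c_gt0 : (0 < c)%N by rewrite -card_v; apply/card_gt0P; exists v.
  have sumRE : (\sum_(w : 'rV[F]_n | w != 0%R) (#|R w|).-1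
             = \sum_(l : 'cV[F]_n | l != 0%R) #|[set w | D w *m l == 0%R]|.-1)%N.
    have pre (T : finType) (A : {set T}) x0 : x0 \in A ->
        #|A|.-1 = (\sum_(x | x != x0) (x \in A))%N.
      move=> Ax0; rewrite (cardsD1 x0) Ax0 -sum1_card big_mkcond /=.
      rewrite [RHS]big_mkcond; apply: eq_bigr => x _; rewrite !inE.
      by case: (x != x0); case: (x \in A).
    under eq_bigr => w _ do rewrite (pre _ _ 0) ?inE ?mulmx0 ?eqxx //.
    under [RHS]eq_bigr => l _ do rewrite (pre _ _ 0) ?inE ?D0 ?mul0mx ?eqxx //.
    rewrite exchange_big /=; apply: eq_bigr => l _.
    by apply: eq_bigr => w _; rewrite !inE.
  have le_sum : (\sum_(w : 'rV[F]_n | w != 0%R) (#|R w|).-1 <= c * #|F|.-1)%N.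
    rewrite sumRE -card_l' -sum_nat_const; apply: leq_sum => l nz_l.
    by have := card_l l nz_l; case: #|_| => // k; case: #|F|.
  move: le_sum; rewrite (bigD1 v) //=.
  have: ((c.-1) * #|F|.-1 <= \sum_(w : 'rV[F]_n | (w != 0%R) && (w != v)) (#|R w|).-1)%N.
    have -> : c.-1 = #|[pred w : 'rV[F]_n | (w != 0) && (w != v)]|.
      rewrite -card_v (cardD1 v) inE nz_v /=; apply: eq_card => w.
      by rewrite !inE andbC.
    rewrite -sum_nat_const; apply: leq_sum => w /andP[nz_w _].
    by have := cardR_ge w nz_w; case: #|R w|; case: #|F|.
  have := cardR_ge v nz_v; case: (c) c_gt0 => // c' _ /=; rewrite mulSn.
  move: (\sum_(_ | _) _)%N => X; move: #|F| F_gt1 #|R v| => q q_gt1 r.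
  move: (c' * _)%N => Y.
  by lia.
pose f v := (char_poly (D v *m invmx S))`_1.
have Pf : polyfun n.-1 f.
  have := graded_polyfun_char_poly (D := fun v => D v *m invmx S).
  move=> /(_ _ 1%N); rewrite n_gt0 subn1; apply=> i j.
  apply: polyfun_ext (fun v => esym (mxE _ _ _ _)) _.
  apply: polyfun_sum => k _.
  apply: polyfun_ext (polyfunM (polyfun_const n 0 (invmx S k j)) (PD i k)) => v.
  exact: mulrC.
have nz_f v : v != 0 -> f v != 0.
  move=> nz_v; have /card_gt1P[l1 [l2 [Rl1 Rl2 neq_l]]] :
    (1 < #|R v|)%N by apply: leq_trans (cardR_ge v nz_v).
  have [l nz_l Dl] : exists2 l : 'cV[F]_n, l != 0 & D v *m l = 0.
    exists (l1 - l2); first by rewrite subr_eq0.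
    by move: Rl1 Rl2; rewrite !inE mulmxBr => /eqP -> /eqP ->; rewrite subrr.
  apply: (@char_poly_coef1_neq0 _ _ _ (u v) (S *m l)).
  - by rewrite mulmxA uD mul0mx.
  - by rewrite mulmxA mulmxKV.
  - by rewrite mulmxA nz_ul.
  by rewrite mxrankMfree ?rkD // row_free_unit unitmx_inv.
(* The degree [(n - 1) * (#|F| - 1)] is small enough for the sum to vanish. But the summand is 1 for
   every [v != 0] and 0 at [v = 0], so the sum is [#|F| ^ n - 1], that is, -1 in [F]. *)
have: \sum_v f v ^+ #|F|.-1 = 0.
  apply: polyfun_sum_eq0 (polyfunX _ Pf) _.
  by rewrite ltn_mul2r ltn_predL n_gt0 andbT -subn1 subn_gt0.
(* The characteristic polynomial of 0 is ['X^n], without linear term because [1 < n]. *)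
have f0 : f 0 = 0.
  rewrite /f D0 mul0mx /char_poly /char_poly_mx map_mx0 subr0 det_scalar coefXn.
  by case: (n) n_gt1 => [|[]].
have F0 : #|F|%:R = 0 :> F.
  by have := expg_cardG (in_setT (1 : F)); rewrite FinRing.zmodXgE cardsT.
rewrite (bigD1 0) //= f0 expr0n (eq_bigr (fun _ => 1)) => [|v nz_v]; last first.
  apply: (mulfI (nz_f v nz_v)); rewrite -exprS prednK ?expf_card ?mulr1 //.
  exact: ltnW.
rewrite sumr_const cardC1 card_mx mul1n -(subn1 #|F|) subn_eq0 leqNgt F_gt1 add0r.
move/(congr1 (fun x => x + 1)); rewrite -mulrSr prednK ?expn_gt0 ?(ltnW F_gt1) //.
rewrite natrX F0 expr0n add0r gtn_eqF // => /eqP.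
by rewrite eq_sym oner_eq0.
Qed.

(** * Matrices attached to pairings of elementary abelian sections *)

Lemma Fp_additive_mulmx q n m (f : 'rV['F_q]_n -> 'rV['F_q]_m) :
  {morph f : v w / v + w} ->
  forall v, f v = v *m \matrix_i f (delta_mx 0 i).
Proof.
move=> fD; have f0 : f 0 = 0 by apply: (addrI (f 0)); rewrite -fD !addr0.
have fMn v k : f (v *+ k) = f v *+ k.
  by elim: k => [|k IHk]; rewrite ?mulr0n // !mulrS fD IHk.
have fZ c v : f (c *: v) = c *: f v.
  by rewrite -[c]natr_Zp !scaler_nat fMn.
move=> v; rewrite {1}[v]row_sum_delta mulmx_sum_row.
rewrite (big_morph f fD f0); apply: eq_bigr => i _.
by rewrite fZ rowK.
Qed.

(** [f] reads off coordinates modulo [A] and [g] picks representatives, so that maps on sections can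
    be handled on elements of [B] itself. *)
Lemma abelem_coordinates (gT : finGroupType) (A B : {group gT}) (q n : nat) :
    prime q -> (0 < n)%N -> A <| B -> q.-abelem (B / A)%g -> #|B : A| = (q ^ n)%N ->
  exists f : gT -> 'rV['F_q]_n, exists g : 'rV['F_q]_n -> gT,
    [/\ {in B &, forall x y, f (x * y)%g = f x + f y},
        {in B, forall x, (f x == 0) = (x \in A)},
        forall v, g v \in B & forall v, f (g v) = v].
Proof.
move=> pr_q n_gt0 nsAB abelE oE; have nAB := normal_norm nsAB.
have ntE : (B / A)%G :!=: 1%g.
  rewrite -cardG_gt1 card_quotient // oE -(expn0 q) ltn_exp2l ?prime_gt1 //.
have dimE : 'dim (B / A)%G = n.
  by apply/eqP; rewrite /= -(eqn_exp2l _ _ (prime_gt1 pr_q)) -oE -card_quotient //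
    -(card_abelem_rV abelE ntE) card_mx card_Fp // mul1n.
have E_nAB x : x \in B -> coset A x \in (B / A)%g by move=> Bx; apply: mem_quotient.
subst n; pose f x := abelem_rV abelE ntE (coset A x).
pose g v := repr (rVabelem abelE ntE v).
have g_coset v : coset A (g v) = rVabelem abelE ntE v by rewrite /g coset_reprK.
have gB v : g v \in B.
  rewrite -(quotientGK nsAB); apply/morphpreP; split; first exact: repr_coset_norm.
  by rewrite /= g_coset mem_rVabelem.
exists f, g; split=> //.
- by move=> x y Bx By; rewrite /f morphM ?(subsetP nAB) //= abelem_rV_M ?E_nAB.
- move=> x Bx; rewrite /f -(abelem_rV_1 abelE ntE).
  rewrite (inj_in_eq (abelem_rV_inj (abelE := abelE) (ntE := ntE))) ?E_nAB ?group1 //.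
  by apply/eqP/idP => [/coset_idr -> //|/coset_id //]; apply: (subsetP nAB).
by move=> v; rewrite /f g_coset rVabelemK.
Qed.

(* [D v] is the matrix of [p x] for [x] over [v]; the hypotheses on the proper
   subgroups [H] of [Y] are those of [no_corank1_matrix_family] on the functional
   with kernel [H]. *)
Lemma no_regular_pairing (gT : finGroupType) (q n : nat)
    (B1 A1 B2 A2 Y : {group gT}) (p : gT -> gT -> gT) (s u : gT -> gT) :
    prime q -> (1 < n)%N ->
    A1 <| B1 -> q.-abelem (B1 / A1)%g -> #|B1 : A1| = (q ^ n)%N ->
    A2 <| B2 -> q.-abelem (B2 / A2)%g -> #|B2 : A2| = (q ^ n)%N ->
    q.-abelem Y -> #|Y| = (q ^ n)%N ->
    {in B1 & B2, forall x z, p x z \in Y} ->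
    {in B1 & B1 & B2, forall x x' z, p (x * x')%g z = (p x z * p x' z)%g} ->
    {in B1 & B2 & B2, forall x z z', p x (z * z')%g = (p x z * p x z')%g} ->
    {in A1 & B2, forall x z, p x z = 1%g} ->
    {in B1 & A2, forall x z, p x z = 1%g} ->
    {in B2, forall z, s z \in Y} ->
    {in B2 &, forall z z', s (z * z')%g = (s z * s z')%g} ->
    {in B2, forall z, s z = 1%g -> z \in A2} -> {in A2, forall z, s z = 1%g} ->
    {in B1, forall x, u x \in B2} -> {in B1, forall x, u x \in A2 -> x \in A1} ->
    {in B1, forall x, p x (u x) = 1%g} ->
    (forall H : {group gT}, H \proper Y ->
       (#|[set x in B1 | [forall z in B2, p x z \in H]]| <= q * #|A1|)%N) ->
    (forall (H : {group gT}) x, H \proper Y -> x \in B1 -> x \notin A1 ->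
       {in B2, forall z, p x z \in H} -> s (u x) \notin H) ->
  False.
Proof.
move=> pr_q n_gt1 nsA1 abel1 o1 nsA2 abel2 o2 abelY oY pY pMl pMr pA1 pA2.
move=> sY sM s_inj sA2 uB uA pu cardH suH; have n_gt0 := ltnW n_gt1.
have nsY1 : 1%G <| Y by apply: normal1.
have [f1 [g1 [f1M f1A g1B g1K]]] := abelem_coordinates pr_q n_gt0 nsA1 abel1 o1.
have [f2 [g2 [f2M f2A g2B g2K]]] := abelem_coordinates pr_q n_gt0 nsA2 abel2 o2.
have [f3 [g3 [f3M f3A g3Y g3K]]] : exists f3 : gT -> 'rV['F_q]_n, exists g3,
    [/\ {in Y &, forall x y, f3 (x * y)%g = f3 x + f3 y},
        {in Y, forall x, (f3 x == 0) = (x \in 1%G)},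
        forall v, g3 v \in Y & forall v, f3 (g3 v) = v].
  by apply: abelem_coordinates => //; [apply: quotient_abelem | rewrite indexg1].
have f31 : f3 1%g = 0 by apply/eqP; rewrite f3A ?group1.
have f21 : f2 1%g = 0 by apply/eqP; rewrite f2A ?group1.
(* A homomorphism from [B2] to [Y] that kills [A2] is a matrix in these coordinates; this serves
   both for [p x] and for [s]. *)
have factor (h : gT -> gT) : {in B2, forall z, h z \in Y} ->
    {in B2 &, forall z z', h (z * z')%g = (h z * h z')%g} ->
    {in A2, forall z, h z = 1%g} ->
    {in B2, forall z, f3 (h z) = f2 z *m \matrix_i f3 (h (g2 (delta_mx 0 i)))}.
  move=> hY hM hA; have sA2B2 := normal_sub nsA2.
  have h_f2 z z' : z \in B2 -> z' \in B2 -> f2 z = f2 z' -> h z = h z'.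
    move=> Bz Bz' eq_f; have A2zz : (z * z'^-1)%g \in A2.
      rewrite -f2A ?groupM ?groupV // f2M ?groupV // eq_f -f2M ?groupV //.
      by rewrite mulgV f21.
    have Bzz := subsetP sA2B2 _ A2zz.
    by rewrite -[z](mulgKV z') hM // hA ?mul1g.
  have hD : {morph (fun w => f3 (h (g2 w))) : v w / v + w}.
    move=> v w /=; rewrite -f3M ?hY // -hM //; congr f3; apply: h_f2 => //.
      by rewrite groupM.
    by rewrite f2M // !g2K.
  move=> z Bz; have := Fp_additive_mulmx hD (f2 z) => /= <-.
  by congr f3; apply: h_f2; rewrite ?g2K.
pose D v := \matrix_i f3 (p (g1 v) (g2 (delta_mx 0 i))).
have DE x z : x \in B1 -> z \in B2 -> f3 (p x z) = f2 z *m D (f1 x).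
  move=> Bx Bz; have sA1B1 := normal_sub nsA1.
  have A1x : (x * (g1 (f1 x))^-1)%g \in A1.
    have f1V y : y \in B1 -> f1 y^-1%g = - f1 y.
      move=> By; apply: (addrI (f1 y)); rewrite -f1M ?groupV // mulgV subrr.
      by apply/eqP; rewrite f1A ?group1.
    by rewrite -f1A ?groupM ?groupV // f1M ?groupV // f1V // g1K subrr.
  have B1x := subsetP sA1B1 _ A1x.
  rewrite -{1}[x](mulgKV (g1 (f1 x))) pMl // pA1 // mul1g.
  apply: (factor (p (g1 (f1 x)))) => //.
  - by move=> y By; apply: pY.
  - by move=> y y' By By'; apply: pMr.
  by move=> y Ay; apply: pA2.
pose S := \matrix_i f3 (s (g2 (delta_mx 0 i))).
have SE z : z \in B2 -> f3 (s z) = f2 z *m S by apply: factor.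
have unitS : S \in unitmx.
  rewrite -row_free_unit; apply: inj_row_free => w wS.
  apply/eqP; rewrite -[w]g2K f2A //; apply: s_inj => //.
  by apply/set1gP; rewrite -f3A ?sY // SE // g2K wS.
have D_add v w : D (v + w) = D v + D w.
  apply/row_matrixP=> i; rewrite linearD /= !rowK.
  by rewrite -f3M ?pY // -pMl // !DE ?groupM // f1M // !g1K.
have PD i j : polyfun 1 (fun v => D v i j).
  have rD : {morph (fun v => row i (D v)) : v w / v + w}.
    by move=> v w /=; rewrite D_add linearD.
  have def_row := Fp_additive_mulmx rD.
  pose c k := D (delta_mx 0 k) i j.
  apply: (@polyfun_ext _ _ _ (fun v => \sum_k v 0 k * c k)); last first.
    by apply: polyfun_sum => k _; apply: polyfun_coord.
  move=> v; have -> : D v i j = row i (D v) 0 j by rewrite [RHS]mxE.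
  rewrite (def_row v) [RHS]mxE; apply: eq_bigr => k _; congr (_ * _).
  by rewrite [RHS]mxE [RHS]mxE.
have q_Fp : #|'F_q| = q by apply: card_Fp.
pose Hset (l : 'cV_n) := [set y in Y | f3 y *m l == 0].
have H_group (l : 'cV_n) : group_set (Hset l).
  apply/group_setP; split; first by rewrite inE group1 f31 mul0mx eqxx.
  move=> x y; rewrite !inE => /andP[Yx /eqP fx] /andP[Yy /eqP fy].
  by rewrite groupM //= f3M // mulmxDl fx fy addr0.
pose Hl (l : 'cV_n) := Group (H_group l).
have H_proper (l : 'cV_n) : l != 0 -> Hl l \proper Y.
  move=> nz_l; apply/properP; split; first by apply/subsetP=> y /setIdP[].
  have [i nz_li] : exists i, l i 0 != 0 by apply/cV0Pn.
  exists (g3 (delta_mx 0 i)); rewrite // !inE g3Y /= g3K -rowE.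
  by apply: contra nz_li => /eqP/matrixP/(_ 0 0); rewrite !mxE => ->.
have HP (l : 'cV_n) x : x \in B1 -> D (f1 x) *m l = 0 -> {in B2, forall z, p x z \in Hl l}.
  by move=> Bx Dl z Bz; rewrite inE pY //= DE // -mulmxA Dl mulmx0.
apply: (@no_corank1_matrix_family _ n D S (fun v => f2 (u (g1 v)))) => //.
- move=> v; apply: contra => /eqP f2u; rewrite -[v]g1K f1A //.
  by apply: uA; rewrite // -f2A ?uB // f2u.
- by move=> v; rewrite -{2}[v]g1K -DE ?uB // pu.
- move=> l nz_l; rewrite q_Fp -(leq_pmul2r (cardG_gt0 A1)).
  apply: leq_trans (cardH _ (H_proper l nz_l)); rewrite -cardsX.
  (* Each vector accounts for a whole coset of [A1], which turns the bound on elements of [B1] into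
     one on vectors. *)
  pose h (va : 'rV['F_q]_n * gT) := (g1 va.1 * va.2)%g.
  have sA1 := subsetP (normal_sub nsA1).
  have f1h v a : a \in A1 -> f1 (h (v, a)) = v.
    move=> Aa; have Ba := sA1 a Aa; have /eqP f1a : f1 a == 0 by rewrite f1A.
    by rewrite /h /= f1M // g1K f1a addr0.
  rewrite -(card_in_imset (f := h)); last first.
    move=> [v a] [w b]; rewrite !inE /= => /andP[_ Aa] /andP[_ Ab] eq_h.
    have eq_vw : v = w by rewrite -(f1h v a) // eq_h f1h.
    by move: eq_h; rewrite eq_vw /h /= => /mulgI ->.
  apply/subset_leq_card/subsetP=> _ /imsetP[[v a] + ->].
  rewrite !inE /= => /andP[/eqP Dl Aa]; have Ba := sA1 a Aa.
  have Bh : h (v, a) \in B1 by rewrite groupM.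
  by rewrite Bh; apply/forall_inP; apply: HP => //; rewrite f1h.
- move=> v l nz_v nz_l Dl; have ltH := H_proper l nz_l.
  have A1v : g1 v \notin A1 by rewrite -f1A // g1K.
  have := suH _ _ ltH (g1B v) A1v; rewrite !inE sY ?uB //= SE ?uB //.
  move=> suv; have {suv}/suv : {in B2, forall z, p (g1 v) z \in Hl l}.
    by apply: HP; rewrite ?g1K.
  by apply: contra => /eqP E; apply/eqP/matrixP=> i j; rewrite !ord1 E mxE.
by apply: (addrI (D 0)); rewrite -D_add !addr0.
Qed.

(** * Galois conjugacy on a Frobenius kernel *)

(** On the cyclic group [<[x]>] the character is a sum of linear ones, whose values are roots of
    unity of order dividing [#|G|]. *)
Lemma cfAut_character_expg (gT : finGroupType) (G : {group gT})
    (u : {rmorphism algC -> algC}) k (chi : 'CF(G)) :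
    (forall z, z ^+ #|G| = 1 -> u z = z ^+ k) -> chi \is a character ->
  {in G, forall x, cfAut u chi x = chi (x ^+ k)%g}.
Proof.
move=> uk Nchi x Gx; rewrite cfunE; have sxG : <[x]> \subset G by rewrite cycle_subG.
have [r def_r] := char_sum_irr (cfRes_char <[x]> Nchi).
have Xx := cycle_id x.
rewrite -(cfResE chi sxG Xx) -(cfResE chi sxG (groupX k Xx)) def_r !sum_cfunE.
rewrite rmorph_sum; apply: eq_bigr => i _.
have lin_i := irr_cyclic_lin i (cycle_cyclic x).
rewrite lin_charX // uk //; have /dvdnP[m ->] := order_dvdG Gx.
by rewrite mulnC exprM lin_char_unity_root // expr1n.
Qed.

Lemma aut_unity_roots (u : {rmorphism algC -> algC}) n :
  (0 < n)%N -> exists2 k, coprime k n & forall z, z ^+ n = 1 -> u z = z ^+ k.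
Proof.
move=> n_gt0; have [w prim_w] := C_prim_root_exists n_gt0.
have [k co_kn uw] := aut_prim_rootP u prim_w; exists k => // z /(prim_rootP prim_w)[i ->].
by rewrite rmorphXn uw -!exprM mulnC.
Qed.

(* For a Frobenius kernel [K] this is what GC* says about [Irr K]: the Galois
   automorphism is encoded by the exponent [k]. *)
Definition GC_kernel (gT : finGroupType) (K L : {group gT}) : Prop :=
  forall i j : Iirr K, i != 0 -> j != 0 -> 'chi_i 1%g = 'chi_j 1%g ->
  exists l, exists k,
    [/\ l \in L, coprime k #|K| & {in K, forall x, 'chi_j x = 'chi_i ((x ^ l) ^+ k)%g}].

(** Nontrivial irreducible characters of [K] induce irreducibly, and to non-linear characters since
    [K] is proper, so GC* applies to the induced ones. Clifford's theorem brings the conjugacy back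
    to [K], where the [K]-part of the conjugating element acts trivially and the Galois automorphism
    is a power map. *)
Lemma Frobenius_GCstar_kernel (gT : finGroupType) (G K L : {group gT}) :
  [Frobenius G = K ><| L] -> GCstar G -> GC_kernel K L.
Proof.
move=> frobG GCG i j nz_i nz_j eq_ij.
have [defG ntK ntL ltKG _] := Frobenius_context frobG.
have [nsKG sLG defKL nKL tiKL] := sdprod_context defG; have [sKG nKG] := andP nsKG.
have frobGK := FrobeniusWker frobG.
have /irrP[s def_s] := irr_induced_Frobenius_ker frobGK nz_i.
have /irrP[t def_t] := irr_induced_Frobenius_ker frobGK nz_j.
have nonlin m (r : Iirr G) : 'Ind[G] 'chi[K]_m = 'chi_r -> 'chi_r 1%g != 1.
  move=> <-; rewrite cfInd1 // irr1_degree -natrM pnatr_eq1.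
  rewrite muln_eq1 negb_and; apply/orP; left.
  by rewrite neq_ltn indexg_gt1 (proper_subn ltKG) orbT.
have [u def_tu] : Galois_conjugate 'chi_s 'chi_t.
  apply: GCG; rewrite ?(nonlin _ _ def_s) ?(nonlin _ _ def_t) //.
  by rewrite -def_s -def_t !cfInd1 // eq_ij.
have [k co_k uk] := aut_unity_roots u (cardG_gt0 K).
have: j \in irr_constt ('Res[K] 'chi_t) by rewrite -constt_Ind_Res def_t constt_irr inE.
have tKi: aut_Iirr u i \in irr_constt ('Res[K] 'chi_t).
  by rewrite -constt_Ind_Res aut_IirrE -cfAutInd def_s -def_tu constt_irr inE.
rewrite irr_consttE (Clifford_Res_sum_cfclass nsKG tKi) cfdotZl mulf_eq0 negb_or.
case/andP=> _.
have [/cfclassP[y Gy def_j] _ | not_j] := boolP ('chi_j \in ('chi_(aut_Iirr u i) ^: G)%CF); last first.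
  rewrite reindex_cfclass // cfdot_suml big1 ?eqxx // => m Cm.
  by rewrite cfdot_irr (_ : m == j = false) //; apply: contraNF not_j => /eqP <-.
have: y \in (K * L)%g by rewrite defKL.
case/mulsgP=> a b Ka Lb def_y; exists b^-1%g; exists k; split; rewrite ?groupV //.
move=> x Kx; have nKb := subsetP nKL b Lb.
have nKa := subsetP (normG K) a Ka.
rewrite def_j def_y cfConjgMnorm // (cfConjg_id _ Ka).
rewrite cfConjgE // aut_IirrE (cfAut_character_expg uk) ?irr_char //.
by rewrite memJ_norm ?groupV.
Qed.

Lemma GC_kernel_quotient (gT : finGroupType) (K L N : {group gT}) :
    N <| K -> L \subset 'N(N) -> L \subset 'N(K) -> GC_kernel K L -> GC_kernel (K / N)%G (L / N)%G.
Proof.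
move=> nsNK nNL nKL GC i j nz_i nz_j eq_ij; have [sNK nNK] := andP nsNK.
have [||| l [k [Ll co_k def_j]]] := GC (mod_Iirr i) (mod_Iirr j).
- by rewrite mod_Iirr_eq0.
- by rewrite mod_Iirr_eq0.
- by rewrite !mod_IirrE // !cfMod1.
exists (coset N l); exists k; split; first exact: mem_quotient.
  exact: coprime_dvdr (dvdn_quotient _ _) co_k.
move=> _ /morphimP[x Nx Kx ->] /=.
have Nl := subsetP nNL l Ll.
have := def_j x Kx; rewrite !mod_IirrE // !cfModE //.
  by move=> ->; rewrite morphX ?morphJ ?groupJ.
by rewrite groupX // memJ_norm // (subsetP nKL).
Qed.

(** * Characters over a character of a central subgroup *)

Definition irr_over (gT : finGroupType) (U K : {group gT}) (lam : Iirr U) :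
    {set Iirr K} :=
  [set i | 'Res[U] 'chi_i == 'chi_i 1%g *: 'chi_lam].

Section CentralCharacter.

Variables (gT : finGroupType) (K U : {group gT}).
Hypothesis cKU : U \subset 'Z(K).

Let sUK : U \subset K. Proof. exact: subset_trans cKU (center_sub K). Qed.

Lemma center_sub_irr_lin (lam : Iirr U) : 'chi_lam \is a linear_char.
Proof.
apply: char_abelianP lam; apply: abelianS cKU (center_abelian K).
Qed.

(** Schur's lemma: the central [z] acts as a scalar in a representation affording ['chi_i], and the
    value of ['chi_i] at [z] identifies the scalar. *)
Lemma irr_overM (lam : Iirr U) i : i \in irr_over K lam ->
  {in K & U, forall x z, 'chi_i (x * z)%g = 'chi_i x * 'chi_lam z}.
Proof.
rewrite inE => /eqP over_i x z Kx Uz; have Kz := subsetP sUK z Uz.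
have: z \in 'Z('chi_i)%CF.
  have := subsetP cKU z Uz; rewrite -cap_cfcenter_irr => /bigcapP/(_ i isT).
  by [].
have chiz : 'chi_i z = 'chi_i 1%g * 'chi_lam z.
  by rewrite -(cfResE 'chi_i sUK Uz) over_i cfunE.
move: ('chi_lam z) chiz => a chiz.
rewrite -{1}irrRepr cfcenter_repr => /setIdP[_ /is_scalar_mxP[c rz]].
move: chiz; rewrite -!irrRepr !cfunE Kx Kz group1 groupM // !mulr1n.
rewrite repr_mxM // rz mul_mx_scalar mxtraceZ mxtrace_scalar repr_mx1.
rewrite mxtrace_scalar => chiz.
have nz : (irr_degree (socle_of_Iirr i))%:R != 0 :> algC.
  by rewrite pnatr_eq0 -lt0n irr_degree_gt0.
have -> : c = a by apply: (mulfI nz); rewrite mulr_natl chiz.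
by rewrite mulrC.
Qed.

Lemma irr_over_lam_exists (i : Iirr K) : exists lam : Iirr U, i \in irr_over K lam.
Proof.
have sUZ : U \subset 'Z('chi_i)%CF.
  by apply: subset_trans cKU _; rewrite -cap_cfcenter_irr bigcap_inf.
have [xi lin_xi def_xi] := cfcenter_Res 'chi_i.
have /irrP[lam def_lam] : 'Res[U] xi \in irr U by apply/lin_char_irr/cfRes_lin_char.
exists lam; rewrite inE -def_lam -(cfResRes _ sUZ (cfcenter_sub _)) def_xi.
by rewrite linearZ.
Qed.

Lemma irr_over_inj (lam mu : Iirr U) i :
  i \in irr_over K lam -> i \in irr_over K mu -> lam = mu.
Proof.
rewrite !inE => /eqP-> /eqP/(scalerI (irr1_neq0 i)).
exact: irr_inj.
Qed.

Lemma irr_overE (lam : Iirr U) i :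
  (i \in irr_over K lam) = (i \in irr_constt ('Ind[K] 'chi_lam)).
Proof.
have [mu over_mu] := irr_over_lam_exists i.
rewrite constt_Ind_Res irr_consttE; move: (over_mu); rewrite inE => /eqP ->.
rewrite cfdotZl cfdot_irr mulf_eq0 (negPf (irr1_neq0 i)) /= pnatr_eq0 eqb0 negbK.
apply/idP/eqP => [over_lam | <- //]; exact: irr_over_inj over_mu over_lam.
Qed.

Lemma irr_over_exists (lam : Iirr U) : exists i, i \in irr_over K lam.
Proof. by have [i] := constt_cfInd_irr lam sUK; rewrite -irr_overE; exists i. Qed.

(** By Frobenius reciprocity each constituent of the induced character occurs with its own degree as
    multiplicity; compare values at 1. *)
Lemma sum_irr_over (lam : Iirr U) :
  \sum_(i in irr_over K lam) 'chi_i 1%g ^+ 2 = #|K : U|%:R.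
Proof.
have := cfInd1 'chi_lam sUK; rewrite (lin_char1 (center_sub_irr_lin lam)) mulr1 => <-.
rewrite {1}['Ind _]cfun_sum_cfdot sum_cfunE [in RHS](bigID (mem (irr_over K lam))) /=.
rewrite [X in _ = _ + X]big1 ?addr0 => [|i]; last first.
  by rewrite irr_overE irr_consttE negbK cfunE => /eqP->; rewrite mul0r.
apply: eq_bigr => i over_i; rewrite cfunE expr2; congr (_ * _).
rewrite -Frobenius_reciprocity; move: over_i; rewrite inE => /eqP ->.
by rewrite cfdotZr cfdot_irr eqxx mulr1 irr1_degree conjC_nat.
Qed.

Lemma irr_over_neq0 (lam : Iirr U) i : i \in irr_over K lam -> lam != 0 -> i != 0.
Proof.
move=> over_i; apply: contraNneq => i0; apply/eqP; apply: irr_over_inj over_i _.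
by rewrite i0 inE !irr0 cfun11 scale1r cfRes_cfun1.
Qed.

(** Since [x ^ y = x * [~ x, y]], conjugation multiplies the value at [x] by ['chi_lam [~ x, y]].
    This is how the support of ['chi_i] is confined to radicals. *)
Lemma irr_over_commg (lam : Iirr U) i x y :
    i \in irr_over K lam -> x \in K -> y \in K -> [~ x, y] \in U ->
  'chi_i x != 0 -> 'chi_lam [~ x, y] = 1.
Proof.
move=> over_i Kx Ky Uxy nz_x; apply: (mulfI nz_x).
by rewrite mulr1 -(irr_overM over_i) // -conjg_mulR cfunJ.
Qed.

Lemma irr_over_GC (lam mu : Iirr U) i j l k :
    i \in irr_over K lam -> j \in irr_over K mu -> 'chi_i 1%g = 'chi_j 1%g ->
    l \in 'N(U) -> {in K, forall x, 'chi_j x = 'chi_i ((x ^ l) ^+ k)%g} ->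
  {in U, forall z, 'chi_mu z = 'chi_lam ((z ^ l) ^+ k)%g}.
Proof.
move=> over_i over_j eq_ij nUl def_j z Uz.
have Uzl : ((z ^ l) ^+ k)%g \in U by rewrite groupX ?memJ_norm.
have: 'chi_j (1 * z)%g = 'chi_i (1 * (z ^ l) ^+ k)%g.
  by rewrite !mul1g def_j // (subsetP sUK).
rewrite (irr_overM over_j) // (irr_overM over_i) // eq_ij.
by move/(mulfI (irr1_neq0 j)).
Qed.

End CentralCharacter.

Lemma coprime_expr_eq1 (R : pzSemiRingType) (z : R) n k :
  coprime k n -> z ^+ n = 1 -> z ^+ k = 1 -> z = 1.
Proof.
move=> co_kn zn zk; have [k0 | k_gt0] := posnP k.
  by move: co_kn; rewrite k0 /coprime gcd0n => /eqP n1; rewrite -[z]expr1 -n1.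
have [a b def_ab _] := egcdnP n k_gt0.
have: z ^+ (a * k) = z ^+ (b * n + 1) by rewrite def_ab (eqP co_kn).
by rewrite mulnC exprD exprM zk [(b * n)%N]mulnC exprM zn !expr1n mul1r expr1.
Qed.

Lemma lin_char_card_unity (gT : finGroupType) (G : {group gT}) (xi : 'CF(G)) x :
  xi \is a linear_char -> x \in G -> xi x ^+ #|G| = 1.
Proof.
move=> lin_xi Gx; have /dvdnP[m ->] := order_dvdG Gx.
by rewrite mulnC exprM lin_char_unity_root // expr1n.
Qed.

Lemma abelian_irr_separates (gT : finGroupType) (Y H : {group gT}) :
  abelian Y -> H \proper Y -> exists2 lam : Iirr Y, lam != 0 & H \subset cfker 'chi_lam.
Proof.
move=> cYY ltHY; have [sHY _] := andP ltHY.
have nsHY : H <| Y by rewrite -sub_abelian_normal.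
have [i nz_i] : exists i : Iirr (Y / H)%G, i != 0.
  apply/existsP; rewrite -negb_forall; apply/negP=> /forallP i0.
  have: (#|Iirr (Y / H)%G| <= 1)%N.
    by rewrite -(card1 (0 : Iirr (Y / H)%G)); apply/subset_leq_card/subsetP=> i _; apply: i0.
  rewrite card_Iirr_abelian ?quotient_abelian // card_quotient ?normal_norm //.
  by rewrite leqNgt indexg_gt1 proper_subn.
exists (mod_Iirr i); first by rewrite mod_Iirr_eq0.
by rewrite mod_IirrE // cfker_mod.
Qed.

(** A power map with exponent coprime to [#|K|] does not change the kernel of a linear character, so
    only the conjugation by [L] remains. *)
Lemma GC_linear_ker (gT : finGroupType) (K L : {group gT}) (i j : Iirr K) :
    GC_kernel K L -> L \subset 'N(K) -> i != 0 -> j != 0 ->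
    'chi_i \is a linear_char -> 'chi_j \is a linear_char ->
  exists2 l, l \in L & cfker 'chi_j = cfker 'chi_i :^ l.
Proof.
move=> GC nKL nz_i nz_j lin_i lin_j.
have [|l [k [Ll co_k def_j]]] := GC i j nz_i nz_j; first by rewrite !lin_char1.
exists l^-1%g; rewrite ?groupV //; apply/setP=> x; rewrite mem_conjgV.
have nKl := subsetP nKL l Ll.
have [Kx | nKx] := boolP (x \in K); last first.
  rewrite [LHS](contraNF (subsetP (cfker_sub _) x) nKx); apply/esym.
  by apply: contraNF nKx => /(subsetP (cfker_sub _)); rewrite memJ_norm.
rewrite !cfkerEirr !inE def_j // !lin_char1 // lin_charX ?memJ_norm //.
apply/eqP/eqP=> [ | ->]; last by rewrite expr1n.
by apply: coprime_expr_eq1 co_k _; rewrite lin_char_card_unity ?memJ_norm.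
Qed.

(* [T] counts the kernels of the nontrivial linear characters, which [L] permutes
   transitively. *)
Lemma GC_kernel_linear (gT : finGroupType) (K L : {group gT}) :
    GC_kernel K L -> L \subset 'N(K) -> solvable K -> K :!=: 1%g ->
  exists q, exists T, [/\ prime q, q.-abelem (K / K^`(1))%g, (T %| #|L|)%N
                        & (T * q.-1 = #|K : K^`(1)|.-1)%N].
Proof.
move=> GC nKL solK ntK.
have [M nsMK pr_KM] := sol_prime_factor_exists solK ntK.
set q := #|K : M| in pr_KM; have [sMK nMK] := andP nsMK.
pose X := [set i : Iirr K | (i != 0) && ('chi_i \is a linear_char)].
(* The linear characters with kernel [A] come from the [q - 1] nontrivial characters of [K / A], all
   faithful because this group has prime order. *)
have card_fiber (A : {group gT}) : A <| K -> #|K : A| = q ->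
    #|[set i in X | cfker 'chi_i == A :> {set gT}]| = q.-1.
  move=> nsAK oKA; have [sAK nAK] := andP nsAK.
  have oKA' : #|(K / A)%g| = q by rewrite card_quotient.
  have cKA : abelian (K / A)%g by rewrite cyclic_abelian // prime_cyclic // oKA'.
  have -> : [set i in X | cfker 'chi_i == A :> {set gT}] =
            @mod_Iirr _ K A @: [set~ (0 : Iirr (K / A)%G)].
    apply/setP=> i; apply/setIdP/imsetP=> [[Xi /eqP kerA] | [j]].
      have sA : A \subset cfker 'chi_i by rewrite kerA.
      exists (quo_Iirr A i); last by rewrite quo_IirrK.
      rewrite !inE -(mod_Iirr_eq0 _ nsAK) quo_IirrK //.
      by move: Xi; rewrite inE => /andP[].
    rewrite !inE => nz_j ->.
    have nz_j' : mod_Iirr j != 0 by rewrite mod_Iirr_eq0.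
    have sA : A \subset cfker 'chi_(mod_Iirr j) by rewrite mod_IirrE // cfker_mod.
    split; first rewrite nz_j' /= mod_IirrE // cfMod_lin_char //.
      by apply/char_abelianP.
    rewrite eqEsubset sA andbT.
    have sKK := cfker_sub 'chi_(mod_Iirr j).
    have dvd_q : (#|K : cfker 'chi_(mod_Iirr j)| %| q)%N by rewrite -oKA indexgS.
    have /orP[/eqP K1 | /eqP Kq] := (proj2 (primeP pr_KM)) _ dvd_q.
      by case/negP: nz_j'; rewrite -subGcfker -indexg_eq1 K1.
    have /eqP := Lagrange_index sKK sA; rewrite oKA Kq -[X in _ == X]muln1.
    by rewrite eqn_pmul2l ?prime_gt0 // indexg_eq1.
  rewrite card_imset; last exact: can_inj (mod_IirrK nsAK).
  by rewrite cardsC1 card_Iirr_abelian // oKA'.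
have [i0 Xi0 kerM] : exists2 i, i \in X & cfker 'chi_i = M.
  have: (0 < #|[set i in X | cfker 'chi_i == M :> {set gT}]|)%N.
    by rewrite card_fiber // -subn1 subn_gt0 prime_gt1.
  by case/card_gt0P=> i /setIdP[Xi /eqP]; exists i.
pose MM := [set cfker 'chi_i | i in X].
have XP i : i \in X -> i != 0 /\ 'chi_i \is a linear_char.
  by rewrite inE => /andP.
have defMM : MM = orbit 'Js L M.
  apply/eqP; rewrite eqEsubset; apply/andP; split.
    apply/subsetP=> _ /imsetP[i Xi ->].
    have [[nz0 lin0] [nz_i lin_i]] := (XP _ Xi0, XP _ Xi).
    have [l Ll ->] := GC_linear_ker GC nKL nz0 nz_i lin0 lin_i.
    by rewrite kerM; apply: mem_orbit.
  apply/subsetP=> _ /imsetP[l Ll ->] /=; rewrite -kerM.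
  have nKl := subsetP nKL l Ll.
  apply/imsetP; exists (conjg_Iirr i0 l).
    rewrite inE conjg_Iirr_eq0 conjg_IirrE cfConjg_lin_char ?andbT //.
      by case: (XP _ Xi0).
    by case: (XP _ Xi0).
  by rewrite conjg_IirrE cfker_conjg.
have indexX i : i \in X -> #|K : cfker 'chi_i| = q.
  move=> Xi; have: cfker 'chi_i \in MM by apply: imset_f.
  rewrite defMM => /imsetP[l Ll ->]; have nKl := subsetP nKL l Ll.
  by rewrite /= -{1}(normP nKl) indexJg.
exists q; exists #|MM|; split=> //.
- apply/abelemP=> //; split; first exact: der_abelian 0 K.
  move=> _ /morphimP[x Nx Kx ->] /=; rewrite -morphX //; apply: coset_id.
  rewrite -cap_cfker_lin_irr; apply/bigcapP=> i lin_i.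
  have [-> | nz_i] := eqVneq i 0; first by rewrite irr0 cfker_cfun1 groupX.
  have Xi : i \in X by rewrite inE nz_i.
  rewrite coset_idr ?groupX //.
    exact: (subsetP (normal_norm (cfker_normal _))).
  rewrite morphX ?(subsetP (normal_norm (cfker_normal _))) // -(indexX i Xi).
  rewrite -card_quotient ?normal_norm ?cfker_normal //.
  by apply: expg_cardG; apply: mem_quotient.
- by rewrite defMM dvdn_orbit.
have oX : #|X| = #|K : K^`(1)|.-1.
  rewrite -card_lin_irr [in RHS](cardD1 0) inE irr0 cfun1_lin_char /=.
  by apply: eq_card => i; rewrite !inE.
rewrite -oX -[#|X|]sum1_card (partition_big_imset (fun i => cfker 'chi_i)) /= -/MM.
rewrite -sum_nat_const; apply: eq_bigr => A /imsetP[i Xi ->].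
rewrite sum1dep_card -(card_fiber (cfker_group 'chi_i)) ?cfker_normal ?indexX //.
Qed.

(** * Counting, and divisibility by [(q ^ n - 1) / (q - 1)] *)

Lemma card_le_rel (T1 T2 : finType) (S : {set T1}) (R : {set T2})
    (P : T1 -> T2 -> bool) :
    (forall s, s \in S -> exists2 r, r \in R & P s r) ->
    (forall s s' r, s \in S -> s' \in S -> r \in R -> P s r -> P s' r -> s = s') ->
  (#|S| <= #|R|)%N.
Proof.
move=> exR injP; pose f s := [pick r in R | P s r].
have fP s : s \in S -> exists r, [/\ f s = Some r, r \in R & P s r].
  move=> Ss; rewrite /f; case: pickP => [r /andP[Rr Psr] | none]; first by exists r.
  by have [r Rr Psr] := exR s Ss; have := none r; rewrite Rr Psr.
rewrite -(card_in_imset (f := f) (D := S)); last first.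
  move=> s s' Ss Ss'; have [r [-> Rr Psr]] := fP s Ss.
  have [r' [-> _ Psr']] := fP s' Ss'; case=> er; rewrite -er in Psr'.
  exact: injP Ss Ss' Rr Psr Psr'.
rewrite -(card_imset R (@Some_inj _)); apply/subset_leq_card/subsetP.
move=> _ /imsetP[s Ss ->]; have [r [-> Rr _]] := fP s Ss; exact: imset_f.
Qed.

Lemma succn_pred_le_expn q n : (1 < q)%N -> (1 < n)%N -> (n.+1 * q.-1 <= q ^ n)%N.
Proof.
move=> q_gt1; elim: n => // -[|[|n]] IHn _ //; first by rewrite -mulnn; nia.
have := IHn isT; rewrite [(q ^ n.+3)%N]expnS; move: (q ^ n.+2)%N => X; nia.
Qed.

Lemma expn_pred_lt (q a b : nat) : (1 < q)%N -> (a < b)%N -> ((q ^ a).-1 < (q ^ b).-1)%N.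
Proof.
move=> q_gt1 lt_ab; have: (q ^ a < q ^ b)%N by rewrite ltn_exp2l.
have Xa : (0 < q ^ a)%N by rewrite expn_gt0 ltnW.
by lia.
Qed.

(** [T] is [1 + q + ... + q ^ (n - 1)], which exceeds [q ^ m - 1] as soon as [m < n]. *)
Lemma Singer_dvd_ge q n T m : (1 < q)%N -> (T * q.-1 = (q ^ n).-1)%N -> (0 < m)%N ->
  (T %| (q ^ m).-1)%N -> (n <= m)%N.
Proof.
move=> q_gt1 defT m_gt0 dvdT; rewrite leqNgt; apply/negP=> lt_mn.
have: (T <= (q ^ m).-1)%N.
  apply: dvdn_leq dvdT; rewrite -(expn0 q).
  by have := expn_pred_lt q_gt1 m_gt0; rewrite expn0.
have: (q * q ^ m <= q ^ n)%N by rewrite -expnS leq_exp2l.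
have: (0 < q ^ m)%N by rewrite expn_gt0 ltnW.
move: defT; move: (q ^ m)%N (q ^ n)%N => X Y; nia.
Qed.

(** Writing [q ^ m - 1] as [q ^ (m - n) * (q ^ n - 1) + (q ^ (m - n) - 1)] shows that [T] also
    divides [q ^ (m - n) - 1]; unless [m = n], this forces [n <= m - n]. *)
Lemma Singer_dvd_eq q n T m : (1 < q)%N -> (T * q.-1 = (q ^ n).-1)%N -> (0 < m)%N ->
  (T %| (q ^ m).-1)%N -> (m < 2 * n)%N -> m = n.
Proof.
move=> q_gt1 defT m_gt0 dvdT lt_m.
have le_nm := Singer_dvd_ge q_gt1 defT m_gt0 dvdT.
have [// | neq_mn] := eqVneq m n; have b_gt0 : (0 < m - n)%N by lia.
have: (n <= m - n)%N; last by lia.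
apply: (Singer_dvd_ge q_gt1 defT b_gt0).
have q_gt0 := ltnW q_gt1; have Xn : (0 < q ^ n)%N by rewrite expn_gt0 q_gt0.
have Xb : (0 < q ^ (m - n))%N by rewrite expn_gt0 q_gt0.
have E : ((q ^ m).-1 = q ^ (m - n) * (q ^ n).-1 + (q ^ (m - n)).-1)%N.
  have -> : (q ^ m = q ^ (m - n) * q ^ n)%N by rewrite -expnD subnK.
  by nia.
by move: dvdT; rewrite E dvdn_addr // dvdn_mull // -defT dvdn_mulr.
Qed.

(* If [l1 != l2] then [z -> (z ^ l1)^-1 * z ^ l2] is a permutation of [U]. *)
Lemma semiregular_lin_char_inj (gT : finGroupType) (U L : {group gT})
    (lam : Iirr U) l1 l2 k :
    L \subset 'N(U) -> semiregular U L -> 'chi_lam \is a linear_char -> lam != 0 ->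
    l1 \in L -> l2 \in L -> coprime k #|U| ->
    {in U, forall z, 'chi_lam ((z ^ l1) ^+ k)%g = 'chi_lam ((z ^ l2) ^+ k)%g} ->
  l1 = l2.
Proof.
move=> nUL regL lin_lam nz_lam Ll1 Ll2 co_k eq_lam.
have Ul l z : l \in L -> z \in U -> (z ^ l)%g \in U.
  by move=> Ll Uz; rewrite memJ_norm ?(subsetP nUL).
pose f z := ((z ^ l1)^-1 * z ^ l2)%g.
apply/eqP; rewrite eq_mulVg1; apply: contraR nz_lam => ntl.
have fU z : z \in U -> f z \in U by move=> Uz; rewrite groupM ?groupV ?Ul.
have lamf z : z \in U -> 'chi_lam (f z) = 1.
  move=> Uz; apply: (coprime_expr_eq1 co_k); first by rewrite lin_char_card_unity ?fU.
  have [U1 U2] := (Ul l1 z Ll1 Uz, Ul l2 z Ll2 Uz).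
  rewrite lin_charM ?groupV // lin_charV // exprMn exprVn.
  rewrite -!lin_charX // (eq_lam z Uz) mulVf //.
  by rewrite lin_char_neq0 ?groupX.
have f_inj : {in U &, injective f}.
  move=> x y Ux Uy eq_f; apply/eqP; rewrite -(inj_eq (conjg_inj l1)) eq_mulgV1.
  have Uxy : ((x * y^-1) ^ l1)%g \in 'C_U[l1^-1 * l2]%g.
    apply/setIP; split; first by rewrite Ul ?groupM ?groupV.
    apply/cent1P/commgP/conjg_fixP.
    rewrite -conjgM mulKVg !conjMg !conjVg; apply: (mulgI (x ^ l1)^-1%g).
    by rewrite mulgA -/(f x) eq_f /f mulgK mulKg.
  move: Uxy; rewrite (regL (l1^-1 * l2)%g) ?inE ?ntl ?groupM ?groupV //.
  by rewrite conjMg conjVg.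
have fUU : f @: U = U.
  apply/eqP; rewrite eqEcard card_in_imset // leqnn andbT.
  by apply/subsetP=> _ /imsetP[x Ux ->]; apply: fU.
rewrite -irr_eq1; apply/eqP/cfun_inP=> w; rewrite -{1}fUU => /imsetP[z Uz ->].
by rewrite lamf // cfun1E fU.
Qed.

(** The standing situation, packaged so that it passes to quotients by [L]-invariant subgroups of
    [K^](1)[normal in]K[, with the same]q[,]n[and]T[. Here]T[is the number of hyperplanes of]K /
    K^[(1)]. *)
Record GCdata (gT : finGroupType) (K L : {group gT}) (q n T : nat) : Prop := {
  gc_nK : L \subset 'N(K);
  gc_reg : semiregular K L;
  gc_ntL : L :!=: 1%g;
  gc_GC : GC_kernel K L;
  gc_prime : prime q;
  gc_pgroup : q.-group K;
  gc_expn : {in K, forall x, (x ^+ q)%g \in K^`(1)%g};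
  gc_index : #|K : K^`(1)| = (q ^ n)%N;
  gc_n : (1 < n)%N;
  gc_dvdT : (T %| #|L|)%N;
  gc_dvdL : (#|L| %| (q ^ n).-1)%N;
  gc_defT : (T * q.-1 = (q ^ n).-1)%N }.

Lemma GCdata_quotient (gT : finGroupType) (K L N : {group gT}) q n T :
    GCdata K L q n T -> N <| K -> L \subset 'N(N) -> N \subset K^`(1)%g ->
  GCdata (K / N)%G (L / N)%G q n T.
Proof.
case=> nKL regL ntL GC pr_q qK expK iK n_gt1 dvdT dvdL defT nsNK nNL sNK'.
have [sNK nNK] := andP nsNK.
have coKL := regular_norm_coprime nKL regL.
have tiKL : K :&: L = 1%g by apply: coprime_TIg.
have defG : (K ><| L)%g = (K <*> L)%G by rewrite sdprodEY.
have sK'K : K^`(1)%g \subset K by apply: der_sub.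
have ltNK : N \proper K.
  apply: sub_proper_trans sNK' _; rewrite properE sK'K -indexg_gt1 iK.
  by rewrite -(expn0 q) ltn_exp2l ?prime_gt1 // ltnW.
have ntK : K :!=: 1%g by apply: contraTneq ltNK => ->; rewrite properE sub1G andbF.
have frobG : [Frobenius K <*> L = K ><| L] by apply/Frobenius_semiregularP.
have nsNG : N <| K <*> L.
  by rewrite /normal (subset_trans sNK (joing_subl _ _)) join_subG nNK.
have frobQ := Frobenius_quotient_ker frobG nsNG ltNK.
have [defQ _ ntLN _ _] := Frobenius_context frobQ.
have [_ _ nKLN _] := sdprodP defQ.
have iKN : #|(K / N)%g : (K / N)^`(1)%g| = (q ^ n)%N.
  rewrite -quotient_der // index_quotient_eq //.
  by rewrite subIset // (subset_trans sNK' _) ?orbT.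
have oLN : #|(L / N)%g| = #|L|.
  rewrite -(card_isog (quotient_isog nNL _)) //.
  by apply/trivgP; rewrite -tiKL setSI.
split=> //.
- exact: Frobenius_reg_ker frobQ.
- exact: GC_kernel_quotient.
- exact: quotient_pgroup.
- move=> _ /morphimP[x Nx Kx ->] /=; rewrite -morphX // -quotient_der //.
  by apply: mem_quotient; apply: expK.
- by rewrite oLN.
- by rewrite oLN.
Qed.

Lemma GCdata_irreducible (gT : finGroupType) (K L A : {group gT}) q n T :
    GCdata K L q n T -> K^`(1)%g \proper A -> A \subset K -> L \subset 'N(A) ->
  A :=: K.
Proof.
move=> gcK /andP[sK'A nsAK'] sAK nAL; set K' := K^`(1)%G.
have pr_q := gc_prime gcK; have q_gt1 := prime_gt1 pr_q.
have nsK'K : K' <| K := der_normal 1 K.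
have nK'L : L \subset 'N(K') := char_norm_trans (der_char 1 K) (gc_nK gcK).
have gcQ := GCdata_quotient gcK nsK'K nK'L (subxx _).
have nK'A : A \subset 'N(K') := subset_trans sAK (normal_norm nsK'K).
have regA : semiregular (A / K')%g (L / K')%g.
  by apply: semiregularS (gc_reg gcQ) => //; apply: quotientS.
have dvdA := regular_norm_dvd_pred (quotient_norms K' nAL) regA.
have qA : q.-group (A / K')%g.
  by apply: quotient_pgroup; apply: pgroupS sAK (gc_pgroup gcK).
have [m oA] := p_natP qA.
have m_gt0 : (0 < m)%N.
  rewrite lt0n; apply: contraNneq nsAK' => m0; rewrite -indexg_eq1 -card_quotient //.
  by rewrite oA m0 expn0.
have le_nm : (n <= m)%N.
  apply: (Singer_dvd_ge q_gt1 (gc_defT gcK) m_gt0); rewrite -oA.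
  exact: dvdn_trans (gc_dvdT gcQ) dvdA.
apply/eqP; rewrite eqEcard sAK /= -(Lagrange (der_sub 1 K)) -(Lagrange sK'A).
rewrite leq_mul2l (gc_index gcK) -card_quotient // oA leq_exp2l //.
by rewrite le_nm orbT.
Qed.

Lemma irr1_pgroup (gT : finGroupType) (K : {group gT}) (q : nat) (i : Iirr K) :
  prime q -> q.-group K -> exists f, 'chi_i 1%g = (q ^ f)%:R.
Proof.
move=> pr_q qK; have [d def_d] : exists d, 'chi_i 1%g = d%:R.
  by apply/natrP; rewrite Cnat_irr1.
have: (d %| #|K|)%N by have := dvd_irr1_cardG i; rewrite def_d dvdC_nat.
have [e ->] := p_natP qK; case/(dvdn_pfactor _ _ pr_q) => f _ def_f.
by exists f; rewrite def_d def_f.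
Qed.

Lemma irr1_central_bound (gT : finGroupType) (K U : {group gT}) (i : Iirr K) :
  U \subset 'Z(K) -> 'chi_i 1%g ^+ 2 <= #|K : U|%:R.
Proof.
move=> cKU; apply: le_trans (leif_le (irr1_bound i)) _.
rewrite ler_nat dvdn_leq // indexgS // (subset_trans cKU) //.
by rewrite -cap_cfcenter_irr bigcap_inf.
Qed.

Section GCcentral.

Variables (gT : finGroupType) (K L U : {group gT}) (q n T : nat).
Hypotheses (gcK : GCdata K L q n T) (cKU : U \subset 'Z(K)) (nUL : L \subset 'N(U)).

Let sUK : U \subset K. Proof. exact: subset_trans cKU (center_sub K). Qed.

Lemma GCdata_central_reg : semiregular U L.
Proof. exact: semiregularS sUK (subxx L) (gc_reg gcK). Qed.

Lemma GCdata_central_dvd : (#|L| %| #|U|.-1)%N.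
Proof. exact: regular_norm_dvd_pred nUL GCdata_central_reg. Qed.

Lemma irr_over_conj (lam mu : Iirr U) (i j : Iirr K) :
    i \in irr_over K lam -> j \in irr_over K mu -> lam != 0 -> mu != 0 ->
    'chi_i 1%g = 'chi_j 1%g ->
  exists l, exists k, [/\ l \in L, coprime k #|K|,
    {in K, forall x, 'chi_j x = 'chi_i ((x ^ l) ^+ k)%g}
    & {in U, forall z, 'chi_mu z = 'chi_lam ((z ^ l) ^+ k)%g}].
Proof.
move=> over_i over_j nz_lam nz_mu eq_ij.
have [l [k [Ll co_k def_j]]] :=
  gc_GC gcK (irr_over_neq0 over_i nz_lam) (irr_over_neq0 over_j nz_mu) eq_ij.
exists l; exists k; split=> //.
by apply: irr_over_GC def_j => //; apply: (subsetP nUL).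
Qed.

(** For [#|U| = q ^ m], [Singer_dvd_eq] leaves only [2 * n <= m] to exclude. Sort the nontrivial
    characters of [U] by the degree [q ^ f] of some character over them: [f <= n] by the index
    bound, and each degree serves at most [#|L| * (q - 1)] characters. Hence [q ^ m - 1] is at most
    [(n + 1) * #|L| * (q - 1)], thus at most [(q ^ n - 1) * q ^ n]. *)
Lemma GCdata_central_card : q.-abelem U -> U :!=: 1%g -> (#|K : U| <= q ^ (2 * n))%N ->
  #|U| = (q ^ n)%N.
Proof.
move=> abelU ntU le_index; have [qU cUU _] := and3P abelU.
have pr_q := gc_prime gcK; have q_gt1 := prime_gt1 pr_q.
have [m oU] := p_natP qU; rewrite oU; congr (q ^ _)%N.
have m_gt0 : (0 < m)%N.
  by move: ntU; rewrite -cardG_gt1 oU; case: m {oU}.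
have dvdTU : (T %| (q ^ m).-1)%N.
  by rewrite -oU (dvdn_trans (gc_dvdT gcK)) // GCdata_central_dvd.
apply: (Singer_dvd_eq q_gt1 (gc_defT gcK) m_gt0 dvdTU).
have lin_U lam : 'chi[U]_lam \is a linear_char := center_sub_irr_lin cKU lam.
pose S (f : nat) := [set lam : Iirr U | (lam != 0) &&
  [exists i in irr_over K lam, 'chi_i 1%g == (q ^ f)%:R]].
have cardS f : (#|S f| <= #|L| * q.-1)%N.
  have [-> | /set0Pn[lam]] := eqVneq (S f) set0; first by rewrite cards0.
  rewrite inE => /andP[nz_lam /existsP[i /andP[over_i /eqP deg_i]]].
  have -> : q.-1 = #|[set~ (Ordinal (ltnW q_gt1))]| by rewrite cardsC1 card_ord.
  rewrite -cardsX.
  pose P (mu : Iirr U) (r : gT * 'I_q) :=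
    [forall z in U, 'chi_mu z == 'chi_lam ((z ^ r.1) ^+ r.2)%g].
  apply: (card_le_rel (P := P)) => [mu | mu nu r _ _ _ Pmu Pnu]; last first.
    apply: irr_inj; apply/cfun_inP=> z Uz.
    by rewrite (eqP (forall_inP Pmu z Uz)) (eqP (forall_inP Pnu z Uz)).
  rewrite inE => /andP[nz_mu /existsP[j /andP[over_j /eqP deg_j]]].
  have [|l [k [Ll co_k _ def_mu]]] := irr_over_conj over_i over_j nz_lam nz_mu.
    by rewrite deg_i deg_j.
  (* On [U], of exponent [q], only [k] modulo [q] matters, and it is nonzero: [q - 1] choices. *)
  have kq : (k %% q < q)%N by rewrite ltn_mod ltnW.
  exists (l, Ordinal kq) => /=.
    rewrite !inE Ll /= -val_eqE /= -/(dvdn q k) -prime_coprime //.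
    rewrite coprime_sym; apply: coprime_dvdr co_k.
    apply: dvdn_trans (cardSg sUK); rewrite oU; case: m m_gt0 {oU dvdTU} => // m _.
    by rewrite expnS dvdn_mulr.
  apply/forall_inP=> z Uz /=; rewrite def_mu //; apply/eqP.
  have Uzl : (z ^ l)%g \in U by rewrite memJ_norm ?(subsetP nUL).
  congr ('chi_lam _); rewrite {1}(divn_eq k q) expgD mulnC expgM.
  by have [_ ->] := abelemP pr_q abelU; rewrite ?expg1n ?mul1g.
have cover_S : [set~ (0 : Iirr U)] \subset \bigcup_(f < n.+1) S f.
  apply/subsetP=> lam; rewrite !inE => nz_lam.
  have [i over_i] := irr_over_exists cKU lam.
  have [f deg_i] := irr1_pgroup i pr_q (gc_pgroup gcK).
  have lt_f : (f < n.+1)%N.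
    have := irr1_central_bound i cKU; rewrite deg_i -natrX ler_nat.
    move/leq_trans/(_ le_index); rewrite -expnM leq_exp2l //; lia.
  apply/bigcupP; exists (Ordinal lt_f) => //; rewrite inE nz_lam /=.
  by apply/existsP; exists i; rewrite over_i deg_i /=.
have: ((q ^ m).-1 <= n.+1 * (#|L| * q.-1))%N.
  rewrite -oU -(card_Iirr_abelian cUU) -(cardsC1 (0 : Iirr U)).
  apply: leq_trans (subset_leq_card cover_S) _.
  apply: (@leq_trans (\sum_(f < n.+1) #|S f|)%N).
    apply: (big_ind2 (fun (A : {set _}) c => (#|A| <= c)%N)); rewrite ?cards0 //.
    move=> A a B b leA leB; apply: leq_trans (leq_add leA leB).
    by rewrite cardsU leq_subr.
  apply: (@leq_trans (\sum_(f < n.+1) (#|L| * q.-1))%N).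
    by apply: leq_sum => f _; apply: cardS.
  by rewrite sum_nat_const card_ord.
rewrite ltnNge => le_m; apply/negP=> le_2n.
have le_c := succn_pred_le_expn q_gt1 (gc_n gcK).
have Xn : (1 < q ^ n)%N by rewrite -(expn0 q) ltn_exp2l // ltnW // (gc_n gcK).
have le_L : (#|L| <= (q ^ n).-1)%N by apply: dvdn_leq (gc_dvdL gcK); lia.
have le_X : (q ^ n * q ^ n <= q ^ m)%N by rewrite -expnD addnn -mul2n leq_exp2l.
move: le_m; rewrite mulnCA => le_m.
have := leq_trans le_m (leq_mul le_L le_c).
by move: (q ^ n)%N (q ^ m)%N Xn le_X => X Y; nia.
Qed.

End GCcentral.

Lemma card_coprime_ord n : #|[set k : 'I_n | coprime n k]| = totient n.
Proof.
rewrite totient_count_coprime big_mkord -sum1_card big_mkcond /=.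
by apply: eq_bigr => k _; rewrite inE; case: (coprime n k).
Qed.

(* The exponent [k] determines the element of [L] that goes with it, because [L]
   acts freely on the nontrivial linear characters of [U]. *)
Lemma irr_over_card_le (gT : finGroupType) (K L U : {group gT}) (q n T e : nat)
    (lam : Iirr U) (i : Iirr K) (Theta : {set Iirr K}) :
    GCdata K L q n T -> U \subset 'Z(K) -> L \subset 'N(U) -> lam != 0 ->
    i \in irr_over K lam -> Theta \subset irr_over K lam ->
    {in Theta, forall j, 'chi_j 1%g = 'chi_i 1%g} ->
    (forall x k, x \in K -> coprime k q ->
       'chi_i (x ^+ k)%g = 'chi_i (x ^+ (k %% q ^ e.+1))%g) ->
  (#|Theta| <= totient (q ^ e.+1))%N.
Proof.
move=> gcK cKU nUL nz_lam over_i sTh deg_Th chi_mod.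
have sUK : U \subset K := subset_trans cKU (center_sub K).
have pr_q := gc_prime gcK; have q_gt0 := prime_gt0 pr_q.
have lin_lam := center_sub_irr_lin cKU lam.
have coKq k : coprime k q -> coprime k #|K|.
  by have [m ->] := p_natP (gc_pgroup gcK); apply: coprimeXr.
rewrite -card_coprime_ord.
pose P (j : Iirr K) (k : 'I_(q ^ e.+1)) := [exists l in L,
  [forall x in K, 'chi_j x == 'chi_i ((x ^ l) ^+ k)%g]].
apply: (card_le_rel (P := P)) => [j Th_j | j j' k Th_j Th_j' co_k].
  have over_j := subsetP sTh j Th_j.
  have [|l [k [Ll co_k def_j _]]] :=
    irr_over_conj gcK cKU nUL over_i over_j nz_lam nz_lam; first by rewrite deg_Th.
  have co_kq : coprime k q.
    have qU : (q %| #|K|)%N.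
      have := gc_index gcK; case: (n) (gc_n gcK) => // n' _.
      rewrite expnS => iK; apply: dvdn_trans (dvdn_indexg K K^`(1)%G).
      by rewrite iK dvdn_mulr.
    exact: coprime_dvdr qU co_k.
  have lt_k : (k %% q ^ e.+1 < q ^ e.+1)%N by rewrite ltn_mod expn_gt0 q_gt0.
  exists (Ordinal lt_k).
    by rewrite inE /= coprime_modr coprime_sym coprimeXr.
  apply/existsP; exists l; rewrite Ll; apply/forall_inP=> x Kx /=.
  rewrite def_j // chi_mod // memJ_norm ?(subsetP (gc_nK gcK)) //.
case/existsP=> l /andP[Ll /forall_inP Pj]; case/existsP=> l' /andP[Ll' /forall_inP Pj'].
have co_kU : coprime k #|U|.
  apply: coprime_dvdr (cardSg sUK) _; apply: coKq.
  by move: co_k; rewrite inE coprime_sym coprime_pexpr.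
have [over_j over_j'] := (subsetP sTh j Th_j, subsetP sTh j' Th_j').
have lamP m h : h \in Theta -> m \in L -> {in K, forall x, 'chi_h x == 'chi_i ((x ^ m) ^+ k)%g} ->
    {in U, forall z, 'chi_lam z = 'chi_lam ((z ^ m) ^+ k)%g}.
  move=> Th_h Lm Ph; apply: (irr_over_GC cKU over_i (subsetP sTh h Th_h)).
  - by rewrite deg_Th.
  - exact: (subsetP nUL).
  by move=> x Kx; apply/eqP; apply: Ph.
have eq_l : l = l'.
  apply: (semiregular_lin_char_inj nUL (GCdata_central_reg gcK cKU) lin_lam nz_lam
           Ll Ll' co_kU) => z Uz.
  by rewrite -(lamP l j) // -(lamP l' j').
apply: irr_inj; apply/cfun_inP=> x Kx.
by rewrite (eqP (Pj x Kx)) (eqP (Pj' x Kx)) eq_l.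
Qed.

(** * Kernels of class 2 *)

Lemma commg_gen_abelem (gT : finGroupType) (A B Z : {group gT}) (q : nat) :
    prime q -> abelian Z -> [~: A, B] \subset Z ->
    {in A & B, forall x y, ([~ x, y] ^+ q = 1)%g} ->
  q.-abelem [~: A, B].
Proof.
move=> pr_q cZZ sABZ expq; apply/abelemP=> //; split; first exact: abelianS cZZ.
have gX : group_set [set z in Z | z ^+ q == 1]%g.
  apply/group_setP; split; first by rewrite inE group1 expg1n eqxx.
  move=> x y; rewrite !inE => /andP[Zx /eqP xq] /andP[Zy /eqP yq].
  rewrite groupM //= expgMn ?xq ?yq ?mulg1 //.
  exact: (centsP cZZ).
suffices sX : [~: A, B] \subset Group gX.
  by move=> x /(subsetP sX); rewrite !inE => /andP[_ /eqP].
rewrite gen_subG; apply/subsetP=> _ /imset2P[x y Ax By ->].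
by rewrite inE expq // eqxx andbT (subsetP sABZ) // mem_commg.
Qed.


(** [T] is [1 + q + ... + q ^ (n - 1)], a sum of [n] odd terms. *)
Lemma odd_Singer q n T : odd q -> (0 < q.-1)%N -> (T * q.-1 = (q ^ n).-1)%N -> odd T = odd n.
Proof.
move=> odd_q q1_gt0; rewrite predn_exp mulnC => /eqP; rewrite eqn_pmul2l // => /eqP ->.
elim: n => [|n IHn]; first by rewrite big_ord0.
by rewrite big_ord_recr /= oddD IHn oddX odd_q orbT addbT.
Qed.

Lemma commg_cfker_cfcenter (gT : finGroupType) (K : {group gT}) (i : Iirr K) x :
  x \in K -> {in K, forall y, [~ x, y] \in cfker 'chi_i} -> x \in 'Z('chi_i)%CF.
Proof.
move=> Kx ker_x; have nKx := subsetP (normal_norm (cfker_normal 'chi_i)) x Kx.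
have: coset (cfker 'chi_i) x \in 'Z(K / cfker 'chi_i)%g.
  apply/centerP; split; first exact: mem_quotient.
  move=> _ /morphimP[y Ny Ky ->] /=; apply/commgP; rewrite -morphR //=.
  by apply/eqP/coset_id/ker_x.
rewrite -cfcenter_eq_center => /morphimP[z Nz Zz /= eq_xz].
have: (x * z^-1)%g \in cfker 'chi_i.
  apply: coset_idr; rewrite ?groupM ?groupV // morphM ?groupV // morphV //= eq_xz.
  by rewrite mulgV.
rewrite -(groupMr _ (groupVr Zz)) => ker_xz.
apply: (subsetP _ _ ker_xz); apply/subsetP=> w ker_w.
have Kw := subsetP (cfker_sub _) w ker_w.
by rewrite irr_cfcenterE // (cfker1 ker_w) ger0_norm // irr1_degree ler0n.
Qed.

Section Class2.

Variables (gT : finGroupType) (K : {group gT}).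
Hypothesis cKK' : K^`(1)%g \subset 'Z(K).

Lemma class2_commMl : {in K & K & K, forall x y z, [~ x * y, z] = [~ x, z] * [~ y, z]}%g.
Proof.
move=> x y z Kx Ky Kz; rewrite commMgJ conjgE.
have /centerP[_ cxz] : [~ x, z] \in 'Z(K) by rewrite (subsetP cKK') // mem_commg.
by rewrite (cxz y Ky) mulKg.
Qed.

Lemma class2_commMr : {in K & K & K, forall x y z, [~ x, y * z] = [~ x, y] * [~ x, z]}%g.
Proof.
move=> x y z Kx Ky Kz; rewrite -[LHS]invg_comm class2_commMl // invMg !invg_comm.
have /centerP[_ cxz] : [~ x, y] \in 'Z(K) by rewrite (subsetP cKK') // mem_commg.
by rewrite cxz // groupR.
Qed.

Lemma class2_commXl k : {in K & K, forall x y, [~ x ^+ k, y] = [~ x, y] ^+ k}%g.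
Proof.
move=> x y Kx Ky; rewrite commXg //.
have /centerP[_ cxy] : [~ x, y] \in 'Z(K) by rewrite (subsetP cKK') // mem_commg.
by rewrite /commute cxy.
Qed.

Lemma class2_der1_abelem q : prime q -> {in K, forall x, (x ^+ q)%g \in K^`(1)%g} ->
  q.-abelem K^`(1)%g.
Proof.
move=> pr_q expK; rewrite derg1.
apply: (@commg_gen_abelem _ K K 'Z(K)%G) => //; first exact: center_abelian.
move=> x y Kx Ky; rewrite -class2_commXl //.
have /centerP[_ cxq] := subsetP cKK' _ (expK x Kx).
by apply/eqP/commgP; rewrite /commute cxq.
Qed.

(** The center is the radical of the form [lam [x, y]], so it depends on [lam] alone; with
    [class2_irr1], all characters over [lam] get the same degree. *)
Lemma class2_cfcenter (lam : Iirr K^`(1)%G) (i : Iirr K) : i \in irr_over K lam ->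
  'Z('chi_i)%CF = [set x in K | [forall y in K, 'chi_lam [~ x, y] == 1]].
Proof.
move=> over_i; have cUK : (K^`(1))%G \subset 'Z(K) := cKK'.
apply/setP=> x; apply/idP/setIdP=> [Zx | [Kx /forall_inP lam1]].
  have Kx := subsetP (cfcenter_sub _) x Zx; split=> //.
  apply/forall_inP=> y Ky; apply/eqP.
  apply: (irr_over_commg cUK over_i) => //; first exact: mem_commg.
  rewrite irr_cfcenterE // in Zx.
  by rewrite -normr_eq0 (eqP Zx) irr1_neq0.
apply: commg_cfker_cfcenter => // y Ky; rewrite cfkerEirr inE -[[~ x, y]]mul1g.
by rewrite (irr_overM cUK over_i) ?(eqP (lam1 y Ky)) ?mulr1 ?mem_commg.
Qed.

Lemma class2_irr1 (i : Iirr K) : 'chi_i 1%g ^+ 2 = #|K : 'Z('chi_i)%CF|%:R.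
Proof.
apply: irr1_abelian_bound; apply: sub_der1_abelian.
by apply: subset_trans cKK' _; rewrite -cap_cfcenter_irr bigcap_inf.
Qed.

End Class2.

(** * Class 2 with [q] odd *)

Section OddClass2.

Variables (gT : finGroupType) (K L : {group gT}) (q n T : nat).
Hypotheses (gcK : GCdata K L q n T) (cKK' : K^`(1)%g \subset 'Z(K)).
Hypotheses (odd_q : odd q) (odd_L : odd #|L|).

Let pr_q : prime q := gc_prime gcK.
Let q_gt1 : (1 < q)%N := prime_gt1 pr_q.
Let q_gt0 : (0 < q)%N := prime_gt0 pr_q.
Let K' := K^`(1)%G.
Let sK'K : K' \subset K := der_sub 1 K.
Let abelK' : q.-abelem K' := class2_der1_abelem cKK' pr_q (gc_expn gcK).
Let nK'L : L \subset 'N(K').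
Proof. exact: char_norm_trans (der_char 1 K) (gc_nK gcK). Qed.
Let K'q z : z \in K' -> (z ^+ q = 1)%g.
Proof. by have [_ expK'] := abelemP pr_q abelK'; apply: expK'. Qed.

Let odd_n : odd n.
Proof.
rewrite -(odd_Singer odd_q _ (gc_defT gcK)); last by case: (q) q_gt1 => [|[]].
by have /dvdnP[m oL] := gc_dvdT gcK; move: odd_L; rewrite oL oddM => /andP[].
Qed.

(** The correction term is [[~ y, x]] to the power [q * (q - 1) / 2], a multiple of [q] because [q]
    is odd. *)
Lemma odd_class2_expM : {in K &, forall x y, ((x * y) ^+ q = x ^+ q * y ^+ q)%g}.
Proof.
move=> x y Kx Ky.
have /centerP[_ cyx] : [~ y, x] \in 'Z(K) by rewrite (subsetP cKK') // mem_commg.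
rewrite expMg_Rmul; try by rewrite /commute cyx.
have cq : ([~ y, x] ^+ q = 1)%g by rewrite K'q // mem_commg.
by rewrite bin2odd // expgM cq expg1n mulg1.
Qed.

(** [R] is the common center of the characters over [lam]. Their number [q ^ d] and degree [q ^ f]
    satisfy [d + 2 * f = n]; the Galois count and the parity of [n] force [d = 1], whence
    [#|R : K'| = q]. *)
Lemma odd_class2_lam (lam : Iirr K') : lam != 0 ->
  exists R : {group gT}, [/\ R \subset K, #|R| = (q * #|K'|)%N,
    {in K, forall x, {in K, forall y, 'chi_lam [~ x, y] = 1} -> x \in R}
    & {in R, forall x, x \notin K' -> 'chi_lam (x ^+ q)%g != 1}].
Proof.
move=> nz_lam; have lin_lam := center_sub_irr_lin cKK' lam.
have [i over_i] := irr_over_exists (cKK' : K' \subset 'Z(K)) lam.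
have eq_deg j : j \in irr_over K lam -> 'chi_j 1%g = 'chi_i 1%g.
  move=> over_j; apply/eqP; rewrite -(@eqrXn2 _ 2) //.
  - by rewrite !class2_irr1 // (class2_cfcenter cKK' over_i) (class2_cfcenter cKK' over_j).
  - by rewrite irr1_degree ler0n.
  by rewrite irr1_degree ler0n.
pose Th := irr_over K lam; have sTh : Th \subset irr_over K lam by [].
have [f deg_i] := irr1_pgroup i pr_q (gc_pgroup gcK).
have cardTh : (#|Th| * q ^ (2 * f) = q ^ n)%N.
  apply/eqP; rewrite -(eqr_nat algC) -(gc_index gcK) -[K^`(1)%g]/(K' : {set gT}).
  rewrite -(sum_irr_over cKK' lam) (eq_bigr (fun _ => 'chi_i 1%g ^+ 2)).
    by rewrite sumr_const deg_i -natrX -expnM [(f * 2)%N]mulnC natrM mulr_natl.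
  by move=> j over_j; rewrite eq_deg.
have [d cardd] : exists d, #|Th| = (q ^ d)%N.
  have: (#|Th| %| q ^ n)%N by rewrite -cardTh dvdn_mulr.
  by case/(dvdn_pfactor _ _ pr_q) => d _ ->; exists d.
have def_n : (d + 2 * f = n)%N.
  by apply/eqP; rewrite -(eqn_exp2l _ _ q_gt1) expnD -cardd cardTh.
have exp2 x : x \in K -> (x ^+ (q ^ 2) = 1)%g.
  by move=> Kx; rewrite expgM K'q // (gc_expn gcK).
(* Exponents count modulo [q ^ 2], so there are at most [q * (q - 1)] characters over [lam], fewer
   than [q ^ 2]. *)
have le_d : (d <= 1)%N.
  have: (#|Th| <= totient (q ^ 2))%N.
    apply: (irr_over_card_le gcK cKK' nK'L nz_lam over_i sTh eq_deg) => x k Kx _.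
    by rewrite [in LHS](divn_eq k (q ^ 2)) expgD mulnC expgM exp2 // expg1n mul1g.
  rewrite cardd totient_pfactor //= expn1 => le_q.
  have: (q ^ d < q ^ 2)%N by apply: leq_ltn_trans le_q _; rewrite -mulnn; nia.
  by rewrite ltn_exp2l.
have d1 : d = 1%N.
  by move: odd_n; rewrite -def_n oddD mul2n odd_double addbF; case: d le_d {cardd def_n} => [|[]].
pose R := 'Z('chi_i)%CF.
have defR := class2_cfcenter cKK' over_i.
have sK'R : K' \subset R.
  by apply: subset_trans cKK' _; rewrite -cap_cfcenter_irr bigcap_inf.
have sRK : R \subset K := cfcenter_sub _.
have oKR : #|K : R| = (q ^ (2 * f))%N.
  apply/eqP; rewrite -(eqr_nat algC) -class2_irr1 // deg_i -natrX -expnM.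
  by rewrite [(f * 2)%N]mulnC.
have oRK' : #|R : K'| = q.
  have := Lagrange_index sRK sK'R; rewrite oKR (gc_index gcK) -def_n d1 expnD expn1.
  by rewrite [RHS]mulnC => /eqP; rewrite eqn_pmul2l ?expn_gt0 ?q_gt0 // => /eqP.
have [x0 Rx0 lam_x0] : exists2 x0, x0 \in R & 'chi_lam (x0 ^+ q)%g != 1.
  have [/existsP[x /and3P[Kx nz_x lamx]] | none] :=
      boolP [exists x, [&& x \in K, 'chi_i x != 0 & 'chi_lam (x ^+ q)%g != 1]].
    exists x => //; rewrite /R defR inE Kx; apply/forall_inP=> y Ky.
    by rewrite (irr_over_commg cKK' over_i) // mem_commg.
  have lam1 x : x \in K -> 'chi_i x != 0 -> 'chi_lam (x ^+ q)%g = 1.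
    move=> Kx nz_x; apply/eqP; apply: contraNT none => lamx.
    by apply/existsP; exists x; rewrite Kx nz_x.
  (* If [lam (x ^ q) = 1] wherever ['chi_i] does not vanish, exponents count modulo [q] only, which
     allows at most [q - 1] of the [q] characters. *)
  have: (#|Th| <= totient (q ^ 1))%N.
    apply: (irr_over_card_le gcK cKK' nK'L nz_lam over_i sTh eq_deg) => x k Kx co_k.
    have xqK' : (x ^+ q)%g \in K' := gc_expn gcK Kx.
    have -> : (x ^+ k = x ^+ (k %% q) * (x ^+ q) ^+ (k %/ q))%g.
      by rewrite -expgM -expgD mulnC addnC -divn_eq.
    rewrite expn1.
    rewrite (irr_overM cKK' over_i (groupX _ Kx) (groupX _ xqK')).
    have [-> | nz_x] := eqVneq ('chi_i (x ^+ (k %% q))%g) 0; first by rewrite mul0r.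
    rewrite (lin_charX lin_lam _ xqK'); suffices ->: 'chi_lam (x ^+ q)%g = 1 by rewrite expr1n mulr1.
    apply: (@coprime_expr_eq1 _ _ q (k %% q)).
    - by rewrite coprime_modl.
    - by rewrite -(lin_charX lin_lam _ xqK') K'q // lin_char1.
    by rewrite -(lin_charX lin_lam _ xqK') -expgM mulnC expgM lam1 ?groupX.
  rewrite cardd d1 totient_pfactor // expn0 muln1 expn1.
  by case: (q) q_gt0 => // m _; rewrite ltnn.
exists [group of R]; split=> //=.
- by rewrite -(Lagrange sK'R) oRK' mulnC.
- move=> x Kx lamx; rewrite /R defR inE Kx; apply/forall_inP=> y Ky.
  by rewrite lamx.
(* The elements of [R] whose [q]-th power lies in the kernel of [lam] form a subgroup that contains
   [K'] and misses [x0]; as [#|R : K'|] is prime, it is [K']. *)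
have gR1 : group_set [set x in R | 'chi_lam (x ^+ q)%g == 1].
  apply/group_setP; split; first by rewrite inE group1 expg1n lin_char1 ?eqxx.
  move=> x y; rewrite !inE => /andP[Rx /eqP lx] /andP[Ry /eqP ly].
  have [Kx Ky] := (subsetP sRK x Rx, subsetP sRK y Ry).
  by rewrite groupM //= odd_class2_expM // lin_charM ?(gc_expn gcK) // lx ly mulr1.
pose R1 := Group gR1.
have sK'R1 : K' \subset R1.
  by apply/subsetP=> x K'x; rewrite inE (subsetP sK'R) //= K'q // lin_char1.
have sR1R : R1 \subset R by apply/subsetP=> x /setIdP[].
have R1K' : R1 \subset K'.
  rewrite -indexg_eq1.
  have dvd_q : (#|R1 : K'| %| q)%N by rewrite -oRK' indexSg.
  have /orP[// | /eqP R1q] := (proj2 (primeP pr_q)) _ dvd_q.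
  have := Lagrange_index sR1R sK'R1; rewrite oRK' R1q => /eqP.
  rewrite -[X in _ == X]mul1n eqn_pmul2r // indexg_eq1 => /subsetP/(_ x0 Rx0).
  by rewrite inE Rx0 (negPf lam_x0).
move=> x Rx; apply: contra => lamx; apply: (subsetP R1K').
by rewrite inE Rx lamx.
Qed.

(** The solutions of [x ^ q = 1] form an [L]-invariant subgroup containing [K']; by irreducibility
    it is [K'] or [K], and [odd_class2_lam] excludes [K]. So [x -> x ^ q] is injective on [K / K'],
    as [no_regular_pairing] requires of [s]. *)
Lemma odd_class2_abelian : K' :==: 1%g.
Proof.
apply: contraT => ntK'; have n_gt1 := gc_n gcK.
have oK' : #|K'| = (q ^ n)%N.
  apply: (GCdata_central_card gcK cKK' nK'L abelK' ntK').
  by rewrite (gc_index gcK) leq_exp2l // leq_pmull.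
have nsK'K : K' <| K := der_normal 1 K.
have abelQ : q.-abelem (K / K')%g.
  apply/abelemP=> //; split; first exact: der_abelian 0 K.
  move=> _ /morphimP[x Nx Kx ->] /=; rewrite -morphX //.
  by apply: coset_id; apply: (gc_expn gcK).
have [_ cK'K' _] := and3P abelK'.
have [lam0 nz_lam0 _] : exists2 lam : Iirr K', lam != 0 & 1%G \subset cfker 'chi_lam.
  by apply: abelian_irr_separates; rewrite ?proper1G.
have exp_inj x : x \in K -> (x ^+ q = 1)%g -> x \in K'.
  pose N0 := [set x in K | x ^+ q == 1]%g.
  have gN0 : group_set N0.
    apply/group_setP; split; first by rewrite inE group1 expg1n eqxx.
    move=> y z; rewrite !inE => /andP[Ky /eqP yq] /andP[Kz /eqP zq].
    by rewrite groupM //= odd_class2_expM // yq zq mulg1.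
  move=> Kx xq; apply: contraT => K'x.
  have sK'N0 : K' \subset Group gN0.
    by apply/subsetP=> z K'z; rewrite inE (subsetP sK'K) //= K'q.
  have ltK'N0 : K' \proper Group gN0.
    by apply/properP; split=> //; exists x => //; rewrite inE Kx xq /=.
  have nN0L : L \subset 'N(Group gN0).
    apply/subsetP=> l Ll; rewrite inE; apply/subsetP=> _ /imsetP[y /setIdP[Ky /eqP yq] ->].
    by rewrite inE memJ_norm ?(subsetP (gc_nK gcK)) // Ky -conjXg yq conj1g /=.
  have sN0K : Group gN0 \subset K by apply/subsetP=> y /setIdP[].
  have defK := GCdata_irreducible gcK ltK'N0 sN0K nN0L.
  have [R [sRK oR _ lamR]] := odd_class2_lam nz_lam0.
  have: ~~ (R \subset K').
    apply: contraL (ltn_Pmull q_gt1 (cardG_gt0 K')) => /subset_leq_card.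
    by rewrite oR -leqNgt.
  case/subsetPn=> y Ry K'y; case/eqP: (lamR y Ry K'y).
  have: y \in Group gN0 by rewrite defK (subsetP sRK).
  by rewrite inE => /andP[_ /eqP->]; rewrite lin_char1 // (center_sub_irr_lin cKK').
exfalso.
apply: (@no_regular_pairing _ q n K K' K K' K' (fun x y => [~ x, y]) (fun x => x ^+ q)%g id) => //.
- exact: (gc_index gcK).
- exact: (gc_index gcK).
- by move=> x y Kx Ky; apply: mem_commg.
- exact: class2_commMl.
- exact: class2_commMr.
- move=> x y K'x Ky; have /centerP[_ cx] := subsetP cKK' _ K'x.
  by apply/eqP/commgP; rewrite /commute cx.
- move=> x y Kx K'y; have /centerP[_ cy] := subsetP cKK' _ K'y.
  by apply/eqP/commgP; rewrite /commute cy.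
- exact: (gc_expn gcK).
- exact: odd_class2_expM.
- by move=> x Kx; apply/eqP/commgP.
- move=> H ltHK'; have [lam nz_lam kerH] := abelian_irr_separates cK'K' ltHK'.
  have [R [_ <- lamR _]] := odd_class2_lam nz_lam.
  apply/subset_leq_card/subsetP=> x /setIdP[Kx /forall_inP xH].
  apply: lamR => // y Ky; rewrite (cfker1 (subsetP kerH _ (xH y Ky))).
  by rewrite lin_char1 // (center_sub_irr_lin cKK').
move=> H x ltHK' Kx K'x xH; have [lam nz_lam kerH] := abelian_irr_separates cK'K' ltHK'.
have [R [_ _ lamR lam_x]] := odd_class2_lam nz_lam.
have lin_lam := center_sub_irr_lin cKK' lam.
have Rx : x \in R.
  apply: lamR => // y Ky; rewrite (cfker1 (subsetP kerH _ (xH y Ky))).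
  by rewrite lin_char1.
apply: contra (lam_x x Rx K'x) => Hx.
by rewrite (cfker1 (subsetP kerH _ Hx)) lin_char1.
Qed.

End OddClass2.

(** * Kernels that are 2-groups *)

Lemma semiregular_trans (gT : finGroupType) (V L : {group gT}) x :
    L \subset 'N(V) -> semiregular V L -> #|L| = #|V|.-1 -> x \in V^# ->
  orbit 'J L x = V^#.
Proof.
move=> nVL regL oL Vx; apply/eqP; rewrite eqEcard; apply/andP; split.
  apply/subsetP=> _ /imsetP[l Ll ->]; move: Vx; rewrite !inE /= conjg_eq1.
  by rewrite memJ_norm ?(subsetP nVL).
rewrite card_orbit astab1J (semiregular_sym regL) // indexg1 oL.
by rewrite (cardsD1 1%g V) group1.
Qed.

Lemma GCdata2_card_compl (gT : finGroupType) (K L : {group gT}) n T :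
  GCdata K L 2 n T -> #|L| = (2 ^ n).-1.
Proof.
move=> gcK; apply/eqP; rewrite eqn_dvd (gc_dvdL gcK) /=.
by have := gc_defT gcK; rewrite muln1 => <-; apply: gc_dvdT gcK.
Qed.

(** * Two-groups of class 2 *)

Section TwoClass2.

Variables (gT : finGroupType) (K L : {group gT}) (n T : nat).
Hypotheses (gcK : GCdata K L 2 n T) (cKK' : K^`(1)%g \subset 'Z(K)).
Hypothesis ntK' : K^`(1)%g != 1%g.

Let K' := K^`(1)%G.
Let sK'K : K' \subset K := der_sub 1 K.
Let nK'L : L \subset 'N(K').
Proof. exact: char_norm_trans (der_char 1 K) (gc_nK gcK). Qed.

Lemma two_class2_der1_abelem : 2.-abelem K'.
Proof. by apply: (class2_der1_abelem cKK' _ (gc_expn gcK)). Qed.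

Lemma two_class2_card_der1 : #|K'| = (2 ^ n)%N.
Proof.
apply: (GCdata_central_card gcK cKK' nK'L two_class2_der1_abelem ntK').
by rewrite (gc_index gcK) leq_exp2l // leq_pmull.
Qed.

(** [L] is transitive on the nontrivial elements of [K / K']. A square-trivial [x] outside [K']
    would thus have a conjugate in every nontrivial coset of the central, elementary abelian [K'],
    so that [K] would have exponent 2 and be abelian. *)
Lemma two_class2_involution x : x \in K -> (x ^+ 2 = 1)%g -> x \in K'.
Proof.
move=> Kx x2; apply: contraT => K'x.
have nsK'K : K' <| K := der_normal 1 K; have nK'K := normal_norm nsK'K.
have gcQ := GCdata_quotient gcK nsK'K nK'L (subxx _).
have K'2 z : z \in K' -> (z ^+ 2 = 1)%g.
  by have [_ exp2] := abelemP (gc_prime gcK) two_class2_der1_abelem; apply: exp2.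
have xQ : coset K' x \in (K / K')^#%g.
  rewrite !inE mem_quotient // andbT; apply: contra K'x => /eqP.
  by apply: coset_idr; apply: (subsetP nK'K).
have transL : orbit 'J (L / K') (coset K' x) = (K / K')^#%g.
  apply: semiregular_trans (gc_nK gcQ) (gc_reg gcQ) _ xQ.
  rewrite (GCdata2_card_compl gcQ) card_quotient // (gc_index gcK) //.
have exp2 y : y \in K -> (y ^+ 2 = 1)%g.
  move=> Ky; have [/K'2 // | K'y] := boolP (y \in K').
  have nK'y := subsetP nK'K y Ky; have nK'x := subsetP nK'K x Kx.
  have: coset K' y \in (K / K')^#%g.
    by rewrite !inE mem_quotient // andbT; apply: contra K'y => /eqP; apply: coset_idr.
  rewrite -transL => /imsetP[_ /morphimP[l Nl Ll ->] /=]; rewrite -morphJ // => eq_y.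
  have Kxl : (x ^ l)%g \in K by rewrite memJ_norm ?(subsetP (gc_nK gcK)).
  have nK'xl := subsetP nK'K _ Kxl.
  have K'z : ((x ^ l)^-1 * y)%g \in K'.
    by apply: coset_idr; rewrite ?groupM ?groupV // morphM ?groupV // morphV //= eq_y mulVg.
  have /centerP[_ cz] := subsetP cKK' _ K'z.
  rewrite -[y](mulKVg (x ^ l)%g) expgMn; last by apply/esym; apply: cz.
  by rewrite (K'2 _ K'z) mulg1 -conjXg x2 conj1g.
case/negP: ntK'; apply/eqP/derG1P.
have /and3P[] // : 2.-abelem K.
apply: exponent2_abelem; apply/exponentP=> y Ky; exact: exp2.
Qed.

(** The involutions are the nontrivial elements of [K']; there are [2 ^ n - 1 = #|L|] of them, so
    the semiregular [L] is transitive on them. Its image in [Aut K] is the solvable group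
    required. *)
Lemma two_class2_Suzuki : solvable L ->
  [/\ Suzuki_2group K, #|K| = (#|K^`(1)%g| ^ 2)%N & #|L| = (#|K^`(1)%g| - 1)%N].
Proof.
move=> solL; have oK' := two_class2_card_der1; have oL := GCdata2_card_compl gcK.
have n_gt1 := gc_n gcK.
have defI : involutions K = K'^#%g.
  apply/setP=> x; rewrite !inE; apply/andP/andP=> [[Kx /eqP ox] | [nt_x K'x]].
    have K'x : x \in K' by apply: two_class2_involution => //; rewrite -ox expg_order.
    by rewrite -order_eq1 ox.
  split; first exact: (subsetP sK'K).
  by rewrite (abelem_order_p two_class2_der1_abelem).
have oI : #|involutions K| = (2 ^ n).-1 by rewrite defI -oK' (cardsD1 1%g K') group1.
have regK' : semiregular K' L := semiregularS sK'K (subxx L) (gc_reg gcK).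
split; last first.
- by rewrite -[K^`(1)%g]/(K' : {set gT}) oK' oL subn1.
- rewrite -(Lagrange sK'K) (gc_index gcK) -[K^`(1)%g]/(K' : {set gT}) oK'.
  by rewrite mulnn.
split.
- exact: (gc_pgroup gcK).
- by apply: contra ntK' => cKK; apply/eqP/derG1P.
- rewrite oI; have: (2 ^ 2 <= 2 ^ n)%N by rewrite leq_exp2l.
  by case: (2 ^ n)%N => [|[|[]]].
exists (conj_aut K @* L)%G; split.
- exact: Aut_conj_aut.
- exact: morphim_sol.
have [x K'x nt_x] := trivgPn _ ntK'.
have Ix : x \in involutions K by rewrite defI !inE nt_x.
have K'1x : x \in K'^#%g by rewrite -defI.
apply/imsetP; exists x => //; rewrite defI -(semiregular_trans nK'L regK' _ K'1x); last first.
  by rewrite oL oK'.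
have Kx := subsetP sK'K x K'x.
apply/setP=> y; apply/imsetP/imsetP=> [[l Ll ->] | [_ /morphimP[l Nl Ll ->] ->]].
  exists (conj_aut K l); first by apply: mem_morphim; rewrite // (subsetP (gc_nK gcK)).
  by rewrite /= /aperm norm_conj_autE // (subsetP (gc_nK gcK)).
by exists l => //; rewrite /= /aperm norm_conj_autE.
Qed.

End TwoClass2.

Lemma sum_mult_eq0 (gT : finGroupType) (G : {group gT}) (h : gT -> algC) a :
    {in G &, forall x y, h (x * y)%g = h x * h y} -> a \in G -> h a != 1 ->
  \sum_(x in G) h x = 0.
Proof.
move=> hM Ga ha; apply/eqP.
have: (h a - 1) * \sum_(x in G) h x = 0.
  rewrite mulrBl mul1r [X in _ - X](reindex_inj (mulgI a)) /= mulr_sumr.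
  rewrite [X in _ - X](eq_bigl (mem G)) => [|x]; last by rewrite groupMl.
  by rewrite -sumrB big1 // => x Gx; rewrite hM // subrr.
by move/eqP; rewrite mulf_eq0 subr_eq0 (negPf ha).
Qed.

(** The terms with [f < n] contribute at most [4 * (4 ^ n - 1) / 3], less than [2 * 4 ^ n]. Applied
    with [c f] the number of characters of degree [2 ^ f]. *)
Lemma sum_four_powers (n : nat) (c : nat -> nat) :
    (forall f, c f <= 4)%N -> (\sum_(f < n.+1) c f * 4 ^ f = 4 ^ n.+1)%N ->
  (2 < c n)%N.
Proof.
move=> c4; rewrite big_ord_recr /= => sum_c; rewrite ltnNge; apply/negP=> cn.
have: (\sum_(f < n) c f * 4 ^ f <= 4 * \sum_(f < n) 4 ^ f)%N.
  by rewrite big_distrr leq_sum //= => f _; rewrite leq_mul2r c4 orbT.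
have := predn_exp 4 n; have: (0 < 4 ^ n)%N by rewrite expn_gt0.
move: sum_c; rewrite expnS.
move: (\sum_(f < n) c f * 4 ^ f)%N (\sum_(f < n) 4 ^ f)%N (4 ^ n)%N => A B X; nia.
Qed.

(** * Two-groups of class 3 *)

Section TwoClass3.

Variables (gT : finGroupType) (K L : {group gT}) (n T : nat).
Hypothesis gcK : GCdata K L 2 n T.

Let K' := K^`(1)%G.
Let M := [~: K', K]%G.

Hypotheses (cKM : M \subset 'Z(K)) (ntM : M :!=: 1%g).

Let sK'K : K' \subset K := der_sub 1 K.
Let nK'L : L \subset 'N(K').
Proof. exact: char_norm_trans (der_char 1 K) (gc_nK gcK). Qed.
Let nsK'K : K' <| K := der_normal 1 K.
Let sMK' : M \subset K'.
Proof. by rewrite commg_subl normal_norm. Qed.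
Let sMK : M \subset K := subset_trans sMK' sK'K.
Let nsMK : M <| K.
Proof. by rewrite /normal sMK cents_norm // centsC (subset_trans cKM) ?subsetIr. Qed.
Let nML : L \subset 'N(M).
Proof. by apply: normsR => //; apply: gc_nK gcK. Qed.
Let nMK' : K' \subset 'N(M) := subset_trans sK'K (normal_norm nsMK).
Let gcQ := GCdata_quotient gcK nsMK nML sMK'.
Let n_gt1 := gc_n gcK.

Let cM z x : z \in M -> x \in K -> commute z x.
Proof. by move=> Mz Kx; have /centerP[_ cz] := subsetP cKM z Mz; apply: cz. Qed.

Lemma two_class3_der1_abelian : abelian K'.
Proof.
have M1 : [~: K', K, K] = 1%g.
  by apply/commG1P; rewrite (subset_trans cKM) // subsetIr.
rewrite /abelian; apply/commG1P; rewrite /= {1}derg1.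
by apply: three_subgroup; rewrite /= 1?(commGC K K') M1.
Qed.

Let derQ : (K / M)^`(1)%g = (K' / M)%g.
Proof. by rewrite -quotient_der // normal_norm. Qed.

Let centerQ : (K / M)^`(1)%g \subset 'Z(K / M)%g.
Proof.
rewrite derQ subsetI quotientS //= quotient_cents2r // .
Qed.

Let ntQ' : (K / M)^`(1)%g != 1%g.
Proof.
rewrite derQ -subG1 quotient_sub1 //.
apply: contra ntM => sK'M; apply/eqP/commG1P.
by rewrite (subset_trans sK'M) // (subset_trans cKM) // subsetIr.
Qed.

Let cKK' : abelian K' := two_class3_der1_abelian.

Let oK'M : #|K' : M| = (2 ^ n)%N.
Proof.
have := two_class2_card_der1 gcQ centerQ ntQ'; by rewrite /= derQ card_quotient.
Qed.

Let K'2 z : z \in K' -> (z ^+ 2)%g \in M.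
Proof.
move=> K'z; have nMz : z \in 'N(M).
  by rewrite (subsetP (normal_norm nsMK)) // (subsetP sK'K).
apply: coset_idr; rewrite ?groupX // morphX //.
have [_ exp2] := abelemP (isT : prime 2) (two_class2_der1_abelem gcQ centerQ).
by apply: exp2; rewrite /= derQ mem_quotient.
Qed.

Let sq_inj x : x \in K -> (x ^+ 2)%g \in M -> x \in K'.
Proof.
move=> Kx Mx2; have nMx := subsetP (normal_norm nsMK) x Kx.
have := @two_class2_involution _ _ _ _ _ gcQ centerQ ntQ' (coset M x).
rewrite mem_quotient // -morphX //= coset_id // derQ => /(_ isT erefl).
case/morphimP=> y Ny K'y /= eq_xy.
have: (x * y^-1)%g \in M.
  by apply: coset_idr; rewrite ?groupM ?groupV // morphM ?groupV // morphV //= eq_xy mulgV.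
by move/(subsetP sMK'); rewrite groupMr // groupV.
Qed.

Let commM x z : x \in K -> z \in K' -> [~ x, z] \in M.
Proof. by move=> Kx K'z; rewrite /= commGC mem_commg. Qed.

Let commMl : {in K & K & K', forall x y z, [~ x * y, z] = [~ x, z] * [~ y, z]}%g.
Proof.
move=> x y z Kx Ky K'z; rewrite commMgJ conjgE (cM _ Ky) ?commM // mulKg //.
Qed.

Let commMr : {in K & K' & K', forall x y z, [~ x, y * z] = [~ x, y] * [~ x, z]}%g.
Proof.
move=> x y z Kx K'y K'z; have Kz := subsetP sK'K z K'z.
rewrite commgMJ conjgE (cM _ Kz) ?commM // mulKg.
by apply: cM; rewrite ?commM // (subsetP sMK) ?commM.
Qed.

Let abelM : 2.-abelem M.
Proof.
apply: (@commg_gen_abelem _ K' K 'Z(K)%G) => //; first exact: center_abelian.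
move=> z x K'z Kx; have Mzx : [~ z, x] \in M by apply: mem_commg.
rewrite -commXg; last by apply/esym; apply: cM; rewrite // (subsetP sK'K).
by apply/eqP/commgP; apply: cM; rewrite ?K'2.
Qed.

Let M2 z : z \in M -> (z ^+ 2 = 1)%g.
Proof. by have [_ exp2] := abelemP (isT : prime 2) abelM; apply: exp2. Qed.

Let K2 x : x \in K -> (x ^+ 2)%g \in K' := gc_expn gcK (x := x).

Let K4 x : x \in K -> (x ^+ 4)%g \in M.
Proof. by move=> Kx; rewrite (expgM x 2 2) K'2 ?K2. Qed.

Let K8 x : x \in K -> (x ^+ 8 = 1)%g.
Proof. by move=> Kx; rewrite (expgM x 4 2) M2 ?K4. Qed.

Let oKM : #|K : M| = (4 ^ n)%N.
Proof. by rewrite -(Lagrange_index sK'K sMK') oK'M (gc_index gcK) -expnMn. Qed.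

Let oM : #|M| = (2 ^ n)%N.
Proof.
apply: (GCdata_central_card gcK cKM nML abelM ntM).
by rewrite oKM (expnM 2 2 n).
Qed.

Let oL : #|L| = (2 ^ n).-1 := GCdata2_card_compl gcK.

(** [(x * z) ^ 2] differs from [x ^ 2] by an element of [M], which is central of exponent 2. Fourth
    powers are thus constant on cosets of [K']. *)
Let exp4M x z : x \in K -> z \in K' -> ((x * z) ^+ 4 = x ^+ 4)%g.
Proof.
move=> Kx K'z; have Kz := subsetP sK'K z K'z.
have Mm : (z ^+ 2 * [~ z, x])%g \in M by rewrite groupM ?K'2 ?mem_commg.
have sq : ((x * z) ^+ 2 = x ^+ 2 * (z ^+ 2 * [~ z, x]))%g.
  rewrite !expg2 -!mulgA; congr (x * _)%g.
  have -> : (z * (x * z) = x * (z ^ x * z))%g by rewrite conjgE !mulgA mulgV mul1g.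
  congr (x * _)%g; rewrite conjg_mulR -mulgA; congr (z * _)%g.
  by apply: cM; rewrite ?mem_commg.
rewrite (expgM _ 2 2) sq expgMn; last by apply/esym; apply: cM => //; rewrite groupX.
by rewrite (M2 Mm) mulg1 -expgM.
Qed.

Let lin_M (lam : Iirr M) : 'chi_lam \is a linear_char := center_sub_irr_lin cKM lam.

(** The [2 ^ n - 1] elements of [L] act freely on the [2 ^ n - 1] nontrivial characters of [M]. *)
Let lam_trans (lam mu : Iirr M) : lam != 0 -> mu != 0 ->
  exists2 l, l \in L & {in M, forall z, 'chi_lam z = 'chi_mu (z ^ l)%g}.
Proof.
move=> nz_lam nz_mu; have regM := GCdata_central_reg gcK cKM.
have inj_L : {in L &, injective (conjg_Iirr mu)}.
  move=> l1 l2 Ll1 Ll2 eq_mu; apply: invg_inj.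
  apply: (@semiregular_lin_char_inj _ M L mu _ _ 1); rewrite ?groupV ?coprime1n //.
  move=> z Mz; rewrite !expg1.
  have := congr1 (fun i => 'chi_i z) eq_mu.
  by rewrite !conjg_IirrE !cfConjgE ?(subsetP nML).
have: conjg_Iirr mu @: L = [set~ 0].
  apply/eqP; rewrite eqEcard; apply/andP; split.
    by apply/subsetP=> _ /imsetP[l Ll ->]; rewrite !inE conjg_Iirr_eq0.
  rewrite card_in_imset // cardsC1 oL.
  by have [_ cMM _] := and3P abelM; rewrite card_Iirr_abelian // oM.
move/setP/(_ lam); rewrite !inE nz_lam => /imsetP[l Ll ->].
exists l^-1%g; rewrite ?groupV // => z Mz.
by rewrite conjg_IirrE cfConjgE ?(subsetP nML).
Qed.

(** For [x] outside [K'], the map [z -> [~ x, z]] from [K' / M] to [M] kills the class of [x ^ 2],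
    nontrivial by [sq_inj]. Its image is therefore proper and lies in the kernel of some nontrivial
    [mu], which [L] carries to [lam]. *)
Let left_radical (lam : Iirr M) : lam != 0 ->
  exists x, [/\ x \in K, x \notin K' & {in K', forall z, 'chi_lam [~ x, z] = 1}].
Proof.
move=> nz_lam; have [_ cMM _] := and3P abelM.
have /subsetPn[x Kx K'x] : ~~ (K \subset K').
  by rewrite -indexg_gt1 (gc_index gcK) -(expn0 2) ltn_exp2l // ltnW.
have fM : {in K' &, {morph (fun z => [~ x, z]) : y z / (y * z)%g}}.
  by move=> y z K'y K'z /=; apply: commMr.
pose f := Morphism fM.
have sfM : f @* K' \subset M.
  by apply/subsetP=> _ /morphimP[z _ K'z ->]; apply: commM.
have kerM : M \subset 'ker f.
  apply/subsetP=> z Mz; have K'z := subsetP sMK' z Mz.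
  apply/kerP=> //=; apply/eqP/commgP/esym; exact: cM.
have ker_x2 : (x ^+ 2)%g \in 'ker f.
  by apply/kerP; rewrite /= ?K2 //; apply/eqP/commgP/commuteX.
have ltfM : f @* K' \proper M.
  rewrite properEcard sfM /= card_morphim setIid oM -oK'M.
  have skK' : 'ker f \subset K' by apply: subsetIl.
  rewrite -(Lagrange_index skK' kerM) ltn_Pmulr // indexg_gt1.
  by apply: contra K'x => /subsetP/(_ _ ker_x2); apply: sq_inj.
have [mu nz_mu ker_mu] := abelian_irr_separates cMM ltfM.
have [l Ll lam_mu] := lam_trans nz_lam nz_mu.
have nKl := subsetP (gc_nK gcK) l Ll; have nK'l := subsetP nK'L l Ll.
exists (x ^ l^-1)%g; rewrite !memJ_norm ?groupV //; split=> // z K'z.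
rewrite lam_mu ?commM ?memJ_norm ?groupV // conjRg conjgKV.
have K'zl : (z ^ l)%g \in K' by rewrite memJ_norm.
rewrite (cfker1 (subsetP ker_mu _ _)) ?lin_char1 //.
exact: (mem_morphim f K'zl K'zl).
Qed.

Let ker_lam (lam : Iirr M) (i : Iirr K) z : i \in irr_over K lam -> z \in M ->
  'chi_lam z = 1 -> z \in cfker 'chi_i.
Proof.
move=> over_i Mz lamz; rewrite cfkerEirr inE -[z]mul1g.
by rewrite (irr_overM cKM over_i) // lamz mulr1.
Qed.

(** For [x] from [left_radical], the subgroup [A] generated by [K'] and [x] is abelian modulo the
    kernel of ['chi_i]. So ['chi_i] is a constituent of a character induced from a linear one of
    [A], and [#|K : A|] is at most [2 ^ (n - 1)]. *)
Let irr1_le (lam : Iirr M) (i : Iirr K) : lam != 0 -> i \in irr_over K lam ->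
  'chi_i 1%g <= (2 ^ n.-1)%:R.
Proof.
move=> nz_lam over_i; have [x [Kx K'x lamx]] := left_radical nz_lam.
pose A := (K' <*> <[x]>)%G.
have sAK : A \subset K by rewrite join_subG sK'K cycle_subG.
have der_ker : A^`(1)%g \subset cfker 'chi_i.
  have nkK : K \subset 'N(cfker 'chi_i) := normal_norm (cfker_normal _).
  apply: der1_min; first exact: subset_trans sAK nkK.
  rewrite quotientY ?(subset_trans sK'K) ?cycle_subG ?(subsetP nkK) //.
  rewrite abelianY !quotient_abelian ?cycle_abelian //=.
  rewrite quotient_cents2r // commGC gen_subG.
  apply/subsetP=> _ /imset2P[z y K'z /cycleP[k ->] ->].
  rewrite -invg_comm groupV; apply: (ker_lam over_i).
    by rewrite commM ?groupX.
  elim: k => [|k IHk]; first by rewrite comm1g lin_char1.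
  by rewrite expgS commMl ?groupX // lin_charM ?commM ?groupX // IHk lamx // mulr1.
have [j Aj] : exists j, j \in irr_constt ('Res[A] 'chi_i).
  by have [j] := constt_cfRes_irr A i; exists j.
have lin_j : 'chi_j \is a linear_char.
  rewrite lin_irr_der1.
  apply: subset_trans (cfker_constt (cfRes_char A (irr_char i)) Aj).
  by rewrite cfker_Res ?irr_char // subsetI der_sub.
have: 'chi_i 1%g <= 'Ind[K] 'chi_j 1%g.
  by rewrite char1_ge_constt ?cfInd_char ?irr_char ?constt_Ind_Res.
move/le_trans; apply; rewrite cfInd1 // (lin_char1 lin_j) mulr1 ler_nat.
have sK'A : K' \subset A by apply: joing_subl.
have := Lagrange_index sAK sK'A; rewrite (gc_index gcK).
have: (1 < #|A : K'|)%N.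
  rewrite indexg_gt1; apply: contra K'x => /subsetP; apply.
  by rewrite (subsetP (joing_subr _ _)) ?cycle_id.
case: (n) n_gt1 => // m _ /=; rewrite expnS => ltA defA.
by rewrite -(leq_pmul2l (isT : 0 < 2)%N) -defA mulnC leq_mul2l ltA orbT.
Qed.

Let oK : #|K| = (2 ^ n * 4 ^ n)%N.
Proof. by rewrite -(Lagrange sMK) oM oKM. Qed.

Let oK' : #|K'| = (2 ^ n * 2 ^ n)%N.
Proof. by rewrite -(Lagrange sMK') oM oK'M. Qed.

Let left_rad (lam : Iirr M) := [set x in K | [forall z in K', 'chi_lam [~ x, z] == 1]].
Let right_rad (lam : Iirr M) := [set z in K' | [forall x in K, 'chi_lam [~ x, z] == 1]].

(** Sum [lam [x, z]] over [K] and [K'] in both orders; an inner sum vanishes off the corresponding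
    radical. *)
Let card_radicals (lam : Iirr M) :
  (#|left_rad lam| * #|K'| = #|K| * #|right_rad lam|)%N.
Proof.
have lin_lam := lin_M lam.
have sumR : \sum_(x in K) \sum_(z in K') 'chi_lam [~ x, z] = (#|left_rad lam| * #|K'|)%:R.
  rewrite (bigID (mem (left_rad lam))) /= [X in _ + X]big1 ?addr0 => [|x].
    rewrite natrM mulr_natl -sumr_const.
    rewrite (eq_bigl (fun x => x \in left_rad lam)) => [|x]; last by rewrite !inE andbA andbb.
    apply: eq_bigr => x /setIdP[_ /forall_inP lamx].
    by rewrite -sumr_const; apply: eq_bigr => z K'z; apply/eqP/lamx.
  rewrite inE => /andP[Kx]; rewrite Kx /= => /forall_inPn[z K'z lamz].
  apply: (@sum_mult_eq0 _ K' (fun z => 'chi_lam [~ x, z]) z) => // y y' K'y K'y' /=.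
  by rewrite commMr // lin_charM ?commM.
have sumZ : \sum_(z in K') \sum_(x in K) 'chi_lam [~ x, z] = (#|K| * #|right_rad lam|)%:R.
  rewrite (bigID (mem (right_rad lam))) /= [X in _ + X]big1 ?addr0 => [|z].
    rewrite mulnC natrM mulr_natl -sumr_const.
    rewrite (eq_bigl (fun x => x \in right_rad lam)) => [|z]; last by rewrite !inE andbA andbb.
    apply: eq_bigr => z /setIdP[_ /forall_inP lamz].
    by rewrite -sumr_const; apply: eq_bigr => x Kx; apply/eqP/lamz.
  rewrite inE => /andP[K'z]; rewrite K'z /= => /forall_inPn[x Kx lamx].
  apply: (@sum_mult_eq0 _ K (fun x => 'chi_lam [~ x, z]) x) => // y y' Ky Ky' /=.
  by rewrite commMl // lin_charM ?commM.
by apply/eqP; rewrite -(eqr_nat algC) -sumR -sumZ exchange_big.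
Qed.

Let lam_sq (lam : Iirr M) z : z \in M -> 'chi_lam z ^+ 2 = 1.
Proof. by move=> Mz; rewrite -(lin_charX (lin_M lam)) // M2 // lin_char1. Qed.

Let irr_over_expgD (lam : Iirr M) i x k m : i \in irr_over K lam -> x \in K ->
  'chi_i (x ^+ (k + 4 * m))%g = 'chi_i (x ^+ k)%g * 'chi_lam (x ^+ 4)%g ^+ m.
Proof.
move=> over_i Kx; rewrite expgD expgM.
rewrite (irr_overM cKM over_i (groupX _ Kx) (groupX _ (K4 Kx))).
by rewrite (lin_charX (lin_M lam) _ (K4 Kx)).
Qed.

(* Some [chi_i] over [lam] differs from its image [chi_j] under the Galois
   automorphism [z -> z ^ 5], where [chi_j x = chi_i x * lam (x ^ 4)]. *)
Let moved_irr (lam : Iirr M) : lam != 0 ->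
  exists i, [/\ i \in irr_over K lam, 'chi_i 1%g = (2 ^ n.-1)%:R
    & exists x, [/\ x \in K, 'chi_i x != 0 & 'chi_lam (x ^+ 4)%g != 1]].
Proof.
move=> nz_lam.
pose Th f := [set j in irr_over K lam | 'chi_j 1%g == (2 ^ f)%:R].
have sTh f : Th f \subset irr_over K lam by apply/subsetP=> j /setIdP[].
have deg_Th f i : i \in Th f -> {in Th f, forall j, 'chi_j 1%g = 'chi_i 1%g}.
  by case/setIdP=> _ /eqP-> j /setIdP[_ /eqP].
(* [K] has exponent dividing 8, and [totient 8 = 4]. *)
have Th4 f : (#|Th f| <= 4)%N.
  have [-> | /set0Pn[i Thi]] := eqVneq (Th f) set0; first by rewrite cards0.
  have over_i := subsetP (sTh f) i Thi.
  apply: (@irr_over_card_le _ _ _ _ _ _ _ 2 _ _ _ gcK cKM nML nz_lam over_i (sTh f)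
            (deg_Th f i Thi)) => x k Kx _.
  by rewrite [in LHS](divn_eq k (2 ^ 3)) expgD mulnC expgM K8 // expg1n mul1g.
have def_n : n = n.-1.+1 by rewrite prednK // ltnW.
have sumTh : (\sum_(f < n.-1.+1) #|Th f| * 4 ^ f = 4 ^ n.-1.+1)%N.
  rewrite -def_n -oKM; apply/eqP; rewrite -(eqr_nat algC) -(sum_irr_over cKM lam).
  rewrite natr_sum (eq_bigr (fun f : 'I_n => \sum_(j in irr_over K lam)
            if 'chi_j 1%g == (2 ^ f)%:R then 'chi_j 1%g ^+ 2 else 0)) => [|f _].
    rewrite exchange_big /=; apply/eqP; apply: eq_bigr => j over_j.
    have [f deg_j] := irr1_pgroup j (isT : prime 2) (gc_pgroup gcK).
    have lt_fn : (f < n)%N.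
      have := irr1_le nz_lam over_j; rewrite deg_j ler_nat leq_exp2l //.
      by rewrite [in X in _ -> X]def_n ltnS.
    rewrite (bigD1 (Ordinal lt_fn)) //= deg_j eqxx big1 ?addr0 // => g neq_gf.
    rewrite eqr_nat eqn_exp2l //; case: eqP => // eq_fg.
    by case/eqP: neq_gf; apply: val_inj.
  rewrite -big_mkcondr natrM mulr_natl -sumr_const.
  apply: eq_big => [j | j /setIdP[_ /eqP ->]]; first by rewrite inE.
  by rewrite -natrX -expnM mulnC expnM.
have := sum_four_powers Th4 sumTh => gt2.
have /card_gt0P[i Thi] : (0 < #|Th n.-1|)%N by apply: ltn_trans gt2.
have over_i := subsetP (sTh _) i Thi.
exists i; split=> //; first by case/setIdP: Thi => _ /eqP.
have [/existsP[x /and3P[]] | none] :=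
    boolP [exists x, [&& x \in K, 'chi_i x != 0 & 'chi_lam (x ^+ 4)%g != 1]].
  by exists x.
(* Without such an [x], the value of ['chi_i] at [x ^ k] depends on [k] modulo 4 only, and
   [totient 4 = 2]. *)
suffices: (#|Th n.-1| <= 2)%N by rewrite leqNgt gt2.
have lam1 x : x \in K -> 'chi_i x != 0 -> 'chi_lam (x ^+ 4)%g = 1.
  move=> Kx nz_x; apply/eqP; apply: contraNT none => lamx.
  by apply/existsP; exists x; rewrite Kx nz_x.
apply: (@irr_over_card_le _ _ _ _ _ _ _ 1 _ _ _ gcK cKM nML nz_lam over_i (sTh _)
            (deg_Th _ i Thi)) => x k Kx co_k.
rewrite [in LHS](divn_eq k (2 ^ 2)) addnC mulnC (irr_over_expgD _ _ over_i Kx).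
have [-> | nz_x] := eqVneq ('chi_i (x ^+ (k %% 2 ^ 2))%g) 0; first by rewrite mul0r.
suffices ->: 'chi_lam (x ^+ 4)%g = 1 by rewrite expr1n mulr1.
apply: (@coprime_expr_eq1 _ _ 2 (k %% 2 ^ 2)).
- by rewrite coprime_sym -(@coprime_pexpl 2) // coprime_modr coprime_sym coprimeXr.
- exact: lam_sq (K4 Kx).
by rewrite -(lin_charX (lin_M lam)) ?K4 // -expgM mulnC expgM lam1 ?groupX.
Qed.

(** As [lam (x ^ 4)] is a sign, [F] is nonnegative, and orthogonality of ['chi_i] to its Galois
    image ['chi_j] gives it total [#|K|]. On the right radical, which lies in the center of
    ['chi_i], it has the constant value [2 * 4 ^ (n - 1)]. *)
Let card_right_rad (lam : Iirr M) : lam != 0 -> (#|right_rad lam| <= 2 * 2 ^ n)%N.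
Proof.
move=> nz_lam; have [i [over_i deg_i [x0 [Kx0 nz_x0 lam_x0]]]] := moved_irr nz_lam.
have co5 : coprime 5 #|K|.
  by have [e ->] := p_natP (gc_pgroup gcK); rewrite coprimeXr.
have [u u5] := Qn_aut_exists co5; pose j := aut_Iirr u i.
have def_j x : x \in K -> 'chi_j x = 'chi_i x * 'chi_lam (x ^+ 4)%g.
  move=> Kx; rewrite aut_IirrE (cfAut_character_expg u5) ?irr_char //.
  by rewrite (irr_over_expgD 1 1 over_i Kx) expg1 expr1.
have neq_ij : i != j.
  apply: contraNneq lam_x0 => eq_ij; apply/eqP; apply: (mulfI nz_x0).
  by rewrite mulr1 -def_j // -eq_ij.
pose F x := `|'chi_i x| ^+ 2 * (1 + 'chi_lam (x ^+ 4)%g).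
have F_ge0 x : x \in K -> 0 <= F x.
  move=> Kx; apply: mulr_ge0; first by rewrite exprn_ge0.
  have /eqP := lam_sq lam (K4 Kx); rewrite sqrf_eq1 => /orP[]/eqP->.
    by rewrite addr_ge0.
  by rewrite subrr.
have sumF : \sum_(x in K) F x = #|K|%:R.
  have nzK : #|K|%:R != 0 :> algC by rewrite pnatr_eq0 -lt0n.
  have: '['chi_i] + '['chi_i, 'chi_j] = 1.
    by rewrite !cfdot_irr eqxx (negPf neq_ij) addr0.
  rewrite !cfdotE -mulrDr -big_split /= => /(congr1 ( *%R #|K|%:R)).
  rewrite mulrA mulfV // mul1r mulr1 => <-; apply: eq_bigr => x Kx.
  rewrite /F normCK def_j // rmorphM /= mulrDr mulr1 mulrA; congr (_ + _ * _).
  have /eqP := lam_sq lam (K4 Kx); rewrite sqrf_eq1 => /orP[]/eqP->.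
    by rewrite rmorph1.
  by rewrite rmorphN rmorph1.
have: (\sum_(z in right_rad lam) F z <= #|K|%:R).
  rewrite -sumF [X in _ <= X](bigID (mem (right_rad lam))) /=.
  rewrite [X in _ <= X + _](eq_bigl (fun x => x \in right_rad lam)) => [|z]; last first.
    by rewrite !inE; case K'z: (z \in K'); rewrite ?andbF // (subsetP sK'K).
  by rewrite lerDl sumr_ge0 // => x /andP[Kx _]; apply: F_ge0.
rewrite (eq_bigr (fun _ => ((2 ^ n.-1) ^ 2 * 2)%:R)) => [|z].
  rewrite sumr_const -mulrnA ler_nat oK.
  have -> : ((2 ^ n.-1) ^ 2 * 2 = 2 * 4 ^ n.-1)%N by rewrite mulnC -expnM [(n.-1 * 2)%N]mulnC expnM.
  have -> : (4 ^ n = 4 * 4 ^ n.-1)%N by rewrite -expnS prednK // ltnW.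
  have: (0 < 4 ^ n.-1)%N by rewrite expn_gt0.
  move: (4 ^ n.-1)%N (2 ^ n)%N => X Y X_gt0.
  have -> : (Y * (4 * X) = 2 * X * (2 * Y))%N.
    by rewrite mulnCA [RHS]mulnACA (mulnC Y).
  by rewrite leq_pmul2l // muln_gt0.
rewrite inE => /andP[K'z /forall_inP lamz]; have Kz := subsetP sK'K z K'z.
have /eqP norm_z : `|'chi_i z| == 'chi_i 1%g.
  rewrite -irr_cfcenterE //; apply: commg_cfker_cfcenter => // x Kx.
  rewrite -invg_comm groupV; apply: (ker_lam over_i); first exact: commM.
  exact/eqP/lamz.
rewrite /F norm_z deg_i (expgM z 2 2) M2 ?K'2 // lin_char1 //.
by rewrite -natrX -[1 + 1]/(2%:R) -natrM.
Qed.

(** The bound passes from the right to the left radical by [card_radicals]. The element [x0] of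
    [moved_irr] lies in the left radical outside [K'], so this radical is [K'] and the coset of
    [x0], on which fourth powers are constant. *)
Let rad_cosets (lam : Iirr M) : lam != 0 ->
  (#|left_rad lam| <= 2 * #|K'|)%N /\
  {in left_rad lam, forall x, x \notin K' -> 'chi_lam (x ^+ 4)%g != 1}.
Proof.
move=> nz_lam; have leR : (#|left_rad lam| <= 2 * #|K'|)%N.
  have := card_radicals lam; rewrite oK (_ : 4 ^ n = #|K'|)%N; last by rewrite oK' -expnMn.
  rewrite -mulnA [(#|K'| * _)%N]mulnC mulnA => /eqP.
  rewrite eqn_pmul2r ?cardG_gt0 // => /eqP ->.
  rewrite oK' mulnCA leq_mul2l; apply/orP; right; exact: card_right_rad.
split=> //; have [i [over_i _ [x0 [Kx0 nz_x0 lam_x0]]]] := moved_irr nz_lam.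
have Rx0 : x0 \in left_rad lam.
  rewrite inE Kx0; apply/forall_inP=> z K'z; apply/eqP.
  apply: (irr_over_commg cKM over_i) => //; first exact: (subsetP sK'K).
  exact: commM.
have K'x0 : x0 \notin K'.
  apply: contra lam_x0 => K'x0; rewrite (expgM x0 2 2) M2 ?K'2 //.
  by rewrite lin_char1.
have defR : K' :|: (x0 *: K')%g = left_rad lam.
  apply/eqP; rewrite eqEcard; apply/andP; split.
    apply/subsetP=> x; rewrite !inE => /orP[K'x | /lcosetP[z K'z ->]].
      rewrite (subsetP sK'K) //; apply/forall_inP=> z K'z.
      by rewrite (eqP (_ : [~ x, z] == 1%g)) ?lin_char1 //; apply/commgP/(centsP cKK').
    have Kz := subsetP sK'K z K'z.
    rewrite groupM //; apply/forall_inP=> y K'y.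
    rewrite commMl // (eqP (_ : [~ z, y] == 1%g)); last by apply/commgP/(centsP cKK').
    by move: Rx0; rewrite mulg1 inE => /andP[_ /forall_inP]; apply.
  rewrite cardsU card_lcoset (_ : K' :&: (x0 *: K')%g = set0); last first.
    apply/setP=> x; rewrite !inE; apply/negP=> /andP[K'x /lcosetP[z K'z def_x]].
    by case/negP: K'x0; rewrite -(groupMr _ K'z) -def_x.
  by rewrite cards0 subn0 addnn -mul2n.
move=> x; rewrite -defR => /setUP[-> // | /lcosetP[z K'z ->]] _.
by rewrite exp4M.
Qed.

(** By transitivity of [L] on the nontrivial elements of [K' / M], a square-trivial [z] outside [M]
    would give [K'] exponent 2. Then all fourth powers in [K] would be trivial, against
    [moved_irr]. *)
Let K'_sq_inj z : z \in K' -> (z ^+ 2 = 1)%g -> z \in M.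
Proof.
move=> K'z z2; apply: contraT => Mz.
have [_ cMM _] := and3P abelM.
have [lam nz_lam _] : exists2 lam : Iirr M, lam != 0 & 1%G \subset cfker 'chi_lam.
  by apply: abelian_irr_separates; rewrite ?proper1G.
have [i [_ _ [x [Kx _ /eqP[]]]]] := moved_irr nz_lam.
suffices K'21 y : y \in K' -> (y ^+ 2 = 1)%g.
  by rewrite (expgM x 2 2) K'21 ?K2 // lin_char1.
have nMQ : (L / M)%g \subset 'N((K' / M)%g) by rewrite quotient_norms.
have regQ : semiregular (K' / M)%g (L / M)%g.
  by apply: semiregularS (gc_reg gcQ); rewrite ?quotientS.
have inQ w : w \in K' -> w \notin M -> coset M w \in (K' / M)^#%g.
  move=> K'w Mw; rewrite !inE mem_quotient // andbT; apply: contra Mw => /eqP.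
  by apply: coset_idr; apply: (subsetP nMK').
have transL := semiregular_trans nMQ regQ _ (inQ z K'z Mz).
move=> K'y; have [/M2 // | My] := boolP (y \in M).
have := inQ y K'y My; rewrite -transL; last first.
  by rewrite (GCdata2_card_compl gcQ) card_quotient // oK'M.
case/imsetP=> _ /morphimP[l Nl Ll ->] /=.
have [nMy nMz] := (subsetP nMK' y K'y, subsetP nMK' z K'z).
rewrite -morphJ // => eq_y.
have K'zl : (z ^ l)%g \in K' by rewrite memJ_norm ?(subsetP nK'L).
have nMzl := subsetP nMK' _ K'zl.
have Mw : ((z ^ l)^-1 * y)%g \in M.
  by apply: coset_idr; rewrite ?groupM ?groupV // morphM ?groupV // morphV //= eq_y mulVg.
rewrite -[y](mulKVg (z ^ l)%g) expgMn; last first.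
  by apply/esym; apply: cM => //; rewrite (subsetP sK'K).
by rewrite (M2 Mw) mulg1 -conjXg z2 conj1g.
Qed.

(** A proper subgroup [H] of [M] lies in the kernel of some nontrivial [lam], and [rad_cosets]
    supplies both conditions of [no_regular_pairing]: the count, and [x ^ 4 \notin H] for
    [x ^ 4 = s (u x)]. *)
Lemma two_class3_absurd : False.
Proof.
have [_ cMM _] := and3P abelM.
have abelQ : 2.-abelem (K / K')%g.
  apply/abelemP=> //; split; first exact: der_abelian 0 K.
  move=> _ /morphimP[x Nx Kx ->] /=; rewrite -morphX //.
  by apply: coset_id; apply: K2.
have abelQ' : 2.-abelem (K' / M)%g.
  by have := two_class2_der1_abelem gcQ centerQ; rewrite /= derQ.
have nsMK' : M <| K' by rewrite /normal sMK'.
have radH (H : {group gT}) : H \proper M -> exists lam : Iirr M,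
    [/\ lam != 0, H \subset cfker 'chi_lam
      & forall x, x \in K -> {in K', forall z, [~ x, z] \in H} -> x \in left_rad lam].
  move=> ltHM; have [lam nz_lam kerH] := abelian_irr_separates cMM ltHM.
  exists lam; split=> // x Kx xH; rewrite inE Kx; apply/forall_inP=> z K'z.
  by rewrite (cfker1 (subsetP kerH _ (xH z K'z))) lin_char1.
apply: (@no_regular_pairing _ 2 n K K' K' M M (fun x y => [~ x, y])
          (fun z => z ^+ 2)%g (fun x => x ^+ 2)%g) => //.
- exact: (gc_index gcK).
- by move=> x z K'x K'z; apply/eqP/commgP/(centsP cKK').
- by move=> x z Kx Mz; apply/eqP/commgP/esym; apply: cM.
- move=> x y K'x K'y; apply: expgMn; exact: (centsP cKK').
- by move=> x Kx; apply/eqP/commgP/commuteX.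
- move=> H ltHM; have [lam [nz_lam _ radP]] := radH H ltHM.
  apply: leq_trans (proj1 (rad_cosets nz_lam)).
  by apply/subset_leq_card/subsetP=> x /setIdP[Kx /forall_inP]; apply: radP.
move=> H x ltHM Kx K'x xH; have [lam [nz_lam kerH radP]] := radH H ltHM.
have := proj2 (rad_cosets nz_lam) x (radP x Kx xH) K'x; apply: contra => Hx.
by rewrite (expgM x 2 2) (cfker1 (subsetP kerH _ Hx)) lin_char1.
Qed.

End TwoClass3.

(** * Reduction of the Frobenius group to class 2 and class 3 *)

Lemma nil_residual_compl_nil (gT : finGroupType) (G K L : {group gT}) :
  (K ><| L)%g = G -> K :=: nil_residual G -> nilpotent L.
Proof.
move=> defG defK; have [/andP[_ nKG] _ _ _ _] := sdprod_context defG.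
rewrite (isog_nil (sdprod_isog defG)); apply/lcnP; exists #|G|.
have := morphim_lcn [morphism of coset K] #|G|.+1 nKG; rewrite -!quotientE => <-.
by rewrite -[X in (X / _)%g]/(nil_residual G) -defK trivg_quotient.
Qed.

Lemma nilpotent_sub_commg_trivg (gT : finGroupType) (K H : {group gT}) :
  nilpotent K -> H \subset K -> H \subset [~: H, K] -> H :=: 1%g.
Proof.
move=> nilK sHK sHHK; apply/eqP; apply: (implyP (forallP nilK H)).
by rewrite subsetI sHK.
Qed.

Theorem theorem3p6 (gT : finGroupType) (G K L : {group gT}) :
  [Frobenius G = K ><| L]%g -> solvable G -> GCstar G ->
  (K :=: nil_residual G)%g ->
  (exists q : nat, prime q /\ (q.-abelem K)%g) \/
  [/\ Suzuki_2group K, #|K| = (#|K^`(1)%g| ^ 2)%N, cyclic L &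
      #|L| = (#|K^`(1)%g| - 1)%N].
Proof.
move=> frobG solG GC defK; have [defG ntK ntL _ _] := Frobenius_context frobG.
have [nsKG sLG _ nKL tiKL] := sdprod_context defG; have [sKG nKG] := andP nsKG.
have solK := solvableS sKG solG; have regL := Frobenius_reg_ker frobG.
have GCk := Frobenius_GCstar_kernel frobG GC.
have [q [T [pr_q abelQ dvdT defT]]] := GC_kernel_linear GCk nKL solK ntK.
have q_gt1 := prime_gt1 pr_q.
pose K' := K^`(1)%G; have nsK'K : K' <| K := der_normal 1 K.
have [sK'K nK'K] := andP nsK'K.
have [qQ _ _] := and3P abelQ; have [n oQ] := p_natP qQ.
have iK : #|K : K'| = (q ^ n)%N by rewrite -card_quotient.
have qK : q.-group K.
  apply: (Frobenius_ker_pgroup frobG solG pr_q).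
  by have : q.-nat #|K : K'| by rewrite iK pnatX pnat_id.
have nilK := pgroup_nil qK.
have expK : {in K, forall x, (x ^+ q)%g \in K'}.
  move=> x Kx; have nK'x := subsetP nK'K x Kx.
  apply: coset_idr; rewrite ?groupX // morphX //.
  by have [_ ->] := abelemP pr_q abelQ; rewrite ?mem_quotient.
have [cKK | ncKK] := boolP (abelian K).
  left; exists q; split=> //; apply/abelemP=> //; split=> // x Kx.
  by have := expK x Kx; rewrite /= (derG1P cKK) => /set1P.
right; have oddL := semiregular_nonabelian_odd nKL regL ncKK.
have cycL : cyclic L.
  apply: Frobenius_compl_odd_nil_cyclic frobG solK oddL _.
  exact: nil_residual_compl_nil defG defK.
(* Otherwise [K / K'] is cyclic, and a nilpotent group with cyclic abelianization is cyclic. *)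
have n_gt1 : (1 < n)%N.
  rewrite ltnNge; apply: contra ncKK => le_n1; apply: cyclic_abelian.
  apply: (cyclic_nilpotent_quo_der1_cyclic nilK).
  case: n le_n1 oQ {iK} => [|[|//]] _ oQ; last by rewrite prime_cyclic // oQ.
  by rewrite (card1_trivg oQ) cyclic1.
have nK'L : L \subset 'N(K') := char_norm_trans (der_char 1 K) nKL.
have dvdL : (#|L| %| (q ^ n).-1)%N.
  have nsK'G : K' <| G := char_normal_trans (der_char 1 K) nsKG.
  have ltK'K : K' \proper K.
    by rewrite properE sK'K -indexg_gt1 iK -(expn0 q) ltn_exp2l // ltnW.
  have := Frobenius_dvd_ker1 (Frobenius_quotient_ker frobG nsK'G ltK'K).
  rewrite oQ -(card_isog (quotient_isog nK'L _)) //.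
  by apply/trivgP; rewrite -tiKL setSI.
have gcK : GCdata K L q n T by split=> //; rewrite defT -iK.
have ntK' : K' :!=: 1%g by apply: contra ncKK => /eqP/derG1P.
pose M := [~: K', K]%G.
have sMK' : M \subset K' by rewrite commg_subl.
have sMK := subset_trans sMK' sK'K.
have nML : L \subset 'N(M) by apply: normsR.
have nMK : K \subset 'N(M) by apply: normsR; rewrite ?normG.
have nsMK : M <| K by apply/andP.
have ltMK' : ~~ (K' \subset M).
  by apply: contra ntK' => sK'M; apply/eqP/(nilpotent_sub_commg_trivg nilK).
(* For odd [q], [K / M] has central derived subgroup, so [odd_class2_abelian] would put [K'] inside
   [M], against nilpotence. *)
have [odd_q | ] := boolP (odd q).
  case/negP: ltMK'; have gcM := GCdata_quotient gcK nsMK nML sMK'.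
  have derM : (K / M)^`(1)%g = (K' / M)%g by rewrite -quotient_der.
  have cQM : (K / M)^`(1)%g \subset 'Z(K / M)%g.
    by rewrite derM subsetI quotientS //= quotient_cents2r.
  have /eqP := odd_class2_abelian gcM cQM odd_q (quotient_odd M oddL).
  by rewrite /= derM => QM1; rewrite -quotient_sub1 ?(subset_trans sK'K nMK) // QM1.
rewrite -dvdn2 dvdn_prime2 // => /eqP eq_q; move: gcK; rewrite -eq_q => gcK.
have [M1 | ntM] := eqVneq (M : {set gT}) 1%g.
  have cKK' : K^`(1)%g \subset 'Z(K) by rewrite subsetI sK'K; apply/commG1P.
  have [] := two_class2_Suzuki gcK cKK' ntK' (solvableS sLG solG).
  by split.
(* Modulo [N] the image of [M] becomes central, and by nilpotence it stays nontrivial. *)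
pose N := [~: M, K]%G.
have sNM : N \subset M by rewrite commg_subl.
have nNL : L \subset 'N(N) by apply: normsR.
have nNK : K \subset 'N(N) by apply: normsR; rewrite ?normG.
have nsNK : N <| K by rewrite /normal (subset_trans sNM).
have gcN := GCdata_quotient gcK nsNK nNL (subset_trans sNM sMK').
have defMN : [~: ((K / N)^`(1))%G, (K / N)%G] = (M / N)%g.
  by rewrite /= -quotient_der // -quotientR // (subset_trans sK'K).
exfalso; apply: (two_class3_absurd gcN).
  by rewrite /= defMN subsetI quotientS //= quotient_cents2r.
rewrite /= defMN -subG1 quotient_sub1 ?(subset_trans sMK nNK) //.
by apply: contra ntM => sMN; apply/eqP/(nilpotent_sub_commg_trivg nilK).
Qed.
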